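(* Let $f:X\to B$ be a special Lagrangian $T^n$-fibration and $b\in B_0$. For $\gamma\in H^1(X_b,\mathbf{Z})\cong H_{n-1}(X_b,\mathbf{Z})=\Lambda^{\vee}\subseteq\mathcal{T}_{B,b}$, the $1$-form $$v\mapsto-\int_\gamma\iota(v)\mathrm{Im}\,\Omega_n$$ coincides with the $1$-form $-h_n(\gamma,\cdot)$. Thus the embedding $R^1f_{0*}\mathbf{Z}\to\mathcal{T}^*_{B_0}$ given by $\gamma\mapsto\big(v\mapsto-\int_\gamma\iota(v)\mathrm{Im}\,\Omega_n\big)$ coincides up to sign with the embedding $R^1f_{0*}\mathbf{Z}\to\mathcal{T}_{B_0}$ composed with the isomorphism $\mathcal{T}_{B_0}\cong\mathcal{T}_{B_0}^*$ induced by the Riemannian metric $h_n$.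
   Context: $X$ is a compact Calabi–Yau $n$-fold with Ricci-flat Kähler form $\omega$ and holomorphic $n$-form $\Omega$, $\omega^n/n!=(-1)^{n(n-1)/2}(i/2)^n\Omega\wedge\bar\Omega$; $f:X\to B$ is a $C^\infty$ special Lagrangian $T^n$-fibration over a real $n$-manifold ($\omega$ and $\mathrm{Im}\,\Omega$ restrict to zero on fibres, which are oriented by $\mathrm{Re}\,\Omega$; general fibre an $n$-torus; local sections exist). $\Delta$ is the discriminant locus, $B_0=B\setminus\Delta$, $f_0$ the restriction of $f$ over $B_0$, $X_b=f^{-1}(b)$. For a tangent vector $v$ of $B$, $\iota(v)\alpha=\alpha(v,\cdot)$ means contraction with any lift of $v$ to $X$, restricted to $X_b$. $\Omega_n=\Omega/\int_{X_b}\Omega$. On $B_0$, $h(v,w)=-\int_{X_b}\iota(v)\omega\wedge\iota(w)\mathrm{Im}\,\Omega$ is a Riemannian metric and $h_n=h/\int_{X_b}\Omega$. Lattices: $\Lambda=H_1(X_b,\mathbf{Z})$ is embedded in $\mathcal{T}_{B,b}^*$ by $\gamma\mapsto(v\mapsto-\int_\gamma\iota(v)\omega)$, and $X_b$ is (after choice of origin) $\mathcal{T}_{B,b}^*/\Lambda$, where $\alpha \in \mathcal{T}_{B,b}^*$ acts by the time-one flow of the vector field $v_\alpha$ with $\iota(v_\alpha)\omega=f^*\alpha$. The dual lattice $\Lambda^\vee=\{\varphi\in\mathcal{T}_{B,b}:\varphi(\Lambda)\subseteq\mathbf{Z}\}$ is canonically $H^1(X_b,\mathbf{Z})$, which gives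 the embedding $R^1f_{0*}\mathbf{Z}\to\mathcal{T}_{B_0}$. $H_{n-1}(X_b,\mathbf{Z})=\bigwedge^{n-1}\Lambda$ is identified with $\Lambda^\vee$ by the perfect pairing $\Lambda\times\bigwedge^{n-1}\Lambda\to\bigwedge^n\Lambda\cong\mathbf{Z}$, the last isomorphism given by the orientation of $X_b$; i.e. for an oriented basis $e_1,\dots,e_n$ of $\Lambda$ with dual basis $e_i^*$, $e_i^*$ corresponds to $(-1)^{i-1}e_1\wedge\cdots\wedge\hat e_i\wedge\cdots\wedge e_n$. *)

(* Defs.v *)
From HB Require Import structures.
From mathcomp Require Import all_boot all_order all_algebra all_fingroup.
From mathcomp Require Import complex.
From mathcomp Require Import all_classical all_reals all_analysis.

Set Implicit Arguments.
Unset Strict Implicit.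
Unset Printing Implicit Defensive.

Import Order.TTheory GRing.Theory Num.Theory numFieldNormedType.Exports.
Local Open Scope classical_set_scope.
Local Open Scope ring_scope.

Fixpoint iter_derive (R : realType) (k l : nat) (vs : seq 'rV[R]_k)
    (g : 'rV[R]_k -> 'rV[R]_l) : 'rV[R]_k -> 'rV[R]_l :=
  if vs is v :: vs' then iter_derive vs' (fun x => 'D_v g x) else g.

(* C^oo on an open set U: every iterated directional derivative exists and is
   again differentiable at every point of U. *)
Definition smooth_on (R : realType) (k l : nat) (U : set 'rV[R]_k)
    (g : 'rV[R]_k -> 'rV[R]_l) : Prop :=
  forall (vs : seq 'rV[R]_k) (x : 'rV[R]_k), U x ->
    differentiable (iter_derive vs g) x.

(* A smooth m-manifold with one preferred chart [phi p : dom p -> cod p] around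
   each point p, of inverse [psi p] ([phi p] and [psi p] are junk outside [dom p]
   and [cod p]). The tangent space at x is 'rV[R]_m, a tangent vector being given
   by its coordinates in the preferred chart at x. *)
Record manifold (R : realType) (m : nat) := Manifold {
  carrier :> topologicalType;
  manifold_hausdorff : hausdorff_space carrier;
  manifold_second_countable : @second_countable carrier;
  dom : carrier -> set carrier;
  cod : carrier -> set 'rV[R]_m;
  phi : carrier -> carrier -> 'rV[R]_m;
  psi : carrier -> 'rV[R]_m -> carrier;
  dom_center : forall p, dom p p;
  dom_open : forall p, open (dom p);
  cod_open : forall p, open (cod p);
  phi_cod : forall p x, dom p x -> cod p (phi p x);
  psi_dom : forall p y, cod p y -> dom p (psi p y);
  phiK : forall p x, dom p x -> psi p (phi p x) = x;
  psiK : forall p y, cod p y -> phi p (psi p y) = y;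
  phi_continuous : forall p x, dom p x -> {for x, continuous (phi p)};
  psi_continuous : forall p y, cod p y -> {for y, continuous (psi p)};
  transition_smooth : forall p q,
    smooth_on [set y | cod p y /\ dom q (psi p y)] (fun y => phi q (psi p y)) }.

Definition smooth_map (R : realType) (m l : nat) (M : manifold R m)
    (N : manifold R l) (U : set M) (g : M -> N) : Prop :=
  (forall x, U x -> {for x, continuous g}) /\
  (forall (p : M) (q : N),
    smooth_on [set y | [/\ cod p y, U (psi p y) & dom q (g (psi p y))]]
              (fun y => phi q (g (psi p y)))).

Definition smooth_euclid (R : realType) (k m : nat) (M : manifold R m)
    (g : 'rV[R]_k -> M) : Prop :=
  continuous g /\
  (forall q : M, smooth_on [set t | dom q (g t)] (fun t => phi q (g t))).

Definition tangent_map (R : realType) (m l : nat) (M : manifold R m)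
    (N : manifold R l) (g : M -> N) (x : M) (u : 'rV[R]_m) : 'rV[R]_l :=
  'D_u (fun y => phi (g x) (g (psi x y))) (phi x x).

Definition tangent_euclid (R : realType) (k m : nat) (M : manifold R m)
    (g : 'rV[R]_k -> M) (t w : 'rV[R]_k) : 'rV[R]_m :=
  'D_w (fun s => phi (g t) (g s)) t.

(* The coordinates of a vector field s in the chart at p are smooth over U. *)
Definition smooth_vector_field (R : realType) (m : nat) (M : manifold R m)
    (U : set M) (s : M -> 'rV[R]_m) : Prop :=
  forall p : M, smooth_on [set y | cod p y /\ U (psi p y)]
    (fun y => let x := psi p y in
       'D_(s x) (fun z => phi p (psi x z)) (phi x x)).

Definition form (K : Type) (R : realType) (m : nat) (M : manifold R m)
    (k : nat) : Type :=
  M -> ('I_k -> 'rV[R]_m) -> K.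

Definition fcons (T : Type) (k : nat) (u : T) (w : 'I_k -> T) : 'I_k.+1 -> T :=
  fun j => oapp w u (unlift ord0 j).

Definition pair2 (T : Type) (u v : T) : 'I_2 -> T := fcons u (fun=> v).

Definition update (T : Type) (k : nat) (w : 'I_k -> T) (i : 'I_k) (u : T) :
    'I_k -> T :=
  fun j => if j == i then u else w j.

Definition pullback (K : Type) (R : realType) (l m k : nat) (M : manifold R m)
    (g : 'rV[R]_l -> M) (theta : form K M k) (t : 'rV[R]_l)
    (w : 'I_k -> 'rV[R]_l) : K :=
  theta (g t) (fun i => tangent_euclid g t (w i)).

(* The coefficient of theta, in the chart at p, on the constant vectors w. *)
Definition coeff (K : Type) (R : realType) (m k : nat) (M : manifold R m)
    (theta : form K M k) (p : M) (w : 'I_k -> 'rV[R]_m) (y : 'rV[R]_m) : K :=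
  pullback (psi p) theta y w.

Definition smooth_form (R : realType) (m k : nat) (M : manifold R m)
    (theta : form R M k) : Prop :=
  [/\ forall x w i (a : R) u v,
        theta x (update w i (a *: u + v)) =
        a * theta x (update w i u) + theta x (update w i v),
      forall x w i j, i != j -> w i = w j -> theta x w = 0
    & forall (p : M) w,
        smooth_on (cod p) (fun y => (coeff theta p w y)%:M : 'rV[R]_1)].

(* d theta = 0; on constant vectors in a chart,
   (d theta)(w_0, ..., w_k) = \sum_i (-1)^i D_(w_i) theta(.., w_i omitted, ..). *)
Definition closed_form (R : realType) (m k : nat) (M : manifold R m)
    (theta : form R M k) : Prop :=
  forall (p : M) (y : 'rV[R]_m) (w : 'I_k.+1 -> 'rV[R]_m), cod p y ->
    \sum_(i < k.+1) (-1) ^+ i *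
      'D_(w i) (fun z => coeff theta p (fun j => w (lift i j)) z : R^o) y = 0.

(* Normalised so that dx_1 /\ dx_2 takes the value 1 on (e_1, e_2). *)
Definition wedge (K : fieldType) (R : realType) (m p q : nat)
    (M : manifold R m) (a : form K M p) (b : form K M q) : form K M (p + q) :=
  fun x w => (p`! * q`!)%:R^-1 *
    \sum_(s : 'S_(p + q)) (-1) ^+ s *
      a x (fun i => w (s (lshift q i))) * b x (fun j => w (s (rshift p j))).

(* The degree of a^(k+1) = a /\ a^k is 2 + k * 2, convertible to k.+1 * 2. *)
Fixpoint wedge_pow (K : fieldType) (R : realType) (m : nat) (M : manifold R m)
    (a : form K M 2) (k : nat) : form K M (k * 2) :=
  match k return form K M (k * 2) with
  | 0 => fun _ _ => 1
  | k'.+1 => wedge a (@wedge_pow K R m M a k')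
  end.
Arguments wedge_pow {K R m M} a k.

Definition re_form (R : realType) (m k : nat) (M : manifold R m)
    (theta : form (complex R) M k) : form R M k :=
  fun x w => complex.Re (theta x w).

Definition im_form (R : realType) (m k : nat) (M : manifold R m)
    (theta : form (complex R) M k) : form R M k :=
  fun x w => complex.Im (theta x w).

Definition conj_form (R : realType) (m k : nat) (M : manifold R m)
    (theta : form (complex R) M k) : form (complex R) M k :=
  fun x w => conjc (theta x w).

(* Multiplication by i on C^n = R^n x R^n, z_j = x_j + i y_j. *)
Definition Jstd (R : realType) (n : nat) (u : 'rV[R]_(n + n)) :
    'rV[R]_(n + n) :=
  row_mx (- rsubmx u) (lsubmx u).

Lemma mul2_addn (n : nat) : (n * 2 = n + n)%N.
Proof. by rewrite muln2 addnn. Qed.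

(* Since the charts are holomorphic, [Jstd] is the complex structure on every
   tangent space. Ricci-flatness of omega is a consequence of
   [cy_normalization]. *)
Record calabi_yau (R : realType) (n : nat) := CalabiYau {
  cy_manifold :> manifold R (n + n);
  cy_compact : compact [set: cy_manifold];
  cy_holomorphic_atlas : forall (p q : cy_manifold) y u,
    cod p y -> dom q (psi p y) ->
    'D_(Jstd u) (fun z => phi q (psi p z)) y =
    Jstd ('D_u (fun z => phi q (psi p z)) y);
  omega : form R cy_manifold 2;
  omega_smooth : smooth_form omega;
  omega_closed : closed_form omega;
  omega_J : forall x u v,
    omega x (pair2 (Jstd u) (Jstd v)) = omega x (pair2 u v);
  omega_positive : forall x u, u != 0 -> 0 < omega x (pair2 u (Jstd u));
  Omega : form (complex R) cy_manifold n;
  Omega_re_smooth : smooth_form (re_form Omega);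
  Omega_im_smooth : smooth_form (im_form Omega);
  (* Omega is of type (n, 0) *)
  Omega_J : forall x w i u,
    Omega x (update w i (Jstd u)) = Complex 0 1 * Omega x (update w i u);
  (* Cauchy-Riemann equations for the coefficients of Omega *)
  Omega_holomorphic : forall (p : cy_manifold) w y u, cod p y ->
    'D_(Jstd u) (fun z => coeff (re_form Omega) p w z : R^o) y =
      - 'D_u (fun z => coeff (im_form Omega) p w z : R^o) y /\
    'D_(Jstd u) (fun z => coeff (im_form Omega) p w z : R^o) y =
      'D_u (fun z => coeff (re_form Omega) p w z : R^o) y;
  (* omega^n / n! = (-1)^(n(n-1)/2) (i/2)^n Omega /\ conj Omega *)
  cy_normalization : forall x (w : 'I_(n + n) -> 'rV[R]_(n + n)),
    Complex (wedge_pow omega n x (fun i => w (cast_ord (mul2_addn n) i))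
             / n`!%:R) 0 =
    (-1) ^+ (n * n.-1)./2 * (Complex 0 1 / 2) ^+ n *
      wedge Omega (conj_form Omega) x w }.
Arguments omega {R n} c x w.
Arguments Omega {R n} c x w.

Definition submersive (R : realType) (m l : nat) (M : manifold R m)
    (N : manifold R l) (g : M -> N) (x : M) : Prop :=
  forall v : 'rV[R]_l, exists u : 'rV[R]_m, tangent_map g x u = v.

Definition discriminant (R : realType) (m l : nat) (M : manifold R m)
    (N : manifold R l) (g : M -> N) : set N :=
  [set b | exists x, g x = b /\ ~ submersive g x].

Definition B0 (R : realType) (m l : nat) (M : manifold R m)
    (N : manifold R l) (g : M -> N) : set N :=
  ~` discriminant g.

Definition vertical (R : realType) (m l : nat) (M : manifold R m)
    (N : manifold R l) (g : M -> N) (x : M) (u : 'rV[R]_m) : Prop :=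
  tangent_map g x u = 0.

(* A is diffeomorphic to R^n / Z^n. *)
Definition is_torus (R : realType) (n m : nat) (M : manifold R m)
    (A : set M) : Prop :=
  exists tau : 'rV[R]_n -> M,
    [/\ smooth_euclid tau,
        range tau = A,
        forall s t, tau s = tau t <->
          exists k : 'rV[int]_n, s - t = map_mx intr k
      & forall t w, tangent_euclid tau t w = 0 -> w = 0].

Record slag_fibration (R : realType) (n : nat) (X : calabi_yau R n)
    (B : manifold R n) (f : X -> B) : Prop := SlagFibration {
  fib_smooth : smooth_map setT f;
  fib_lagrangian : forall x u v, submersive f x ->
    vertical f x u -> vertical f x v -> omega X x (pair2 u v) = 0;
  fib_special : forall x (w : 'I_n -> 'rV[R]_(n + n)), submersive f x ->
    (forall i, vertical f x (w i)) -> im_form (Omega X) x w = 0;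
  fib_torus : forall b, B0 f b -> is_torus n (f @^-1` [set b]);
  fib_section : forall b, exists (U : set B) (s : B -> X),
    [/\ open U, U b, smooth_map U s & forall y, U y -> f (s y) = y] }.

(* iota(v) theta along the fibre over b, for v in T_b B: the lift of v is chosen
   arbitrarily at each point. When theta vanishes on fibres, the value on vertical
   vectors does not depend on the choice. *)
Definition contract (K : Type) (R : realType) (m l k : nat)
    (M : manifold R m) (N : manifold R l) (g : M -> N) (v : 'rV[R]_l)
    (theta : form K M k.+1) : form K M k :=
  fun x w => theta x (fcons (xget 0 [set u | tangent_map g x u = v]) w).

Fixpoint cube_integral (R : realType) (k : nat) : ('rV[R]_k -> R) -> R :=
  match k return ('rV[R]_k -> R) -> R with
  | 0 => fun g => g 0
  | k'.+1 => fun g => Rintegral (@lebesgue_measure R) `[0, 1]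
      (fun t : R => cube_integral
         (fun y : 'rV[R]_k' => g (\row_j fcons t (fun i => y 0 i) j)))
  end.

Definition int_cube (R : realType) (k m : nat) (M : manifold R m)
    (sigma : 'rV[R]_k -> M) (theta : form R M k) : R :=
  cube_integral
    (fun t => pullback sigma theta t (fun i : 'I_k => delta_mx 0 i)).

(* Finite formal sums of cubes. A cube is a map on R^k; only its restriction to
   [0,1]^k matters, see [chain_mult]. *)
Definition chain (R : realType) (m : nat) (M : manifold R m) (k : nat) : Type :=
  seq (int * ('rV[R]_k -> M)).

Definition int_chain (R : realType) (k m : nat) (M : manifold R m)
    (c : chain M k) (theta : form R M k) : R :=
  \sum_(p <- c) p.1%:~R * int_cube p.2 theta.

Definition unit_cube (R : realType) (k : nat) : set 'rV[R]_k :=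
  [set t | forall i, 0 <= t 0 i <= 1].

Definition chain_mult (R : realType) (k m : nat) (M : manifold R m)
    (c : chain M k) (sigma : 'rV[R]_k -> M) : int :=
  \sum_(p <- c)
    (if `[< forall t, unit_cube t -> p.2 t = sigma t >] then p.1 else 0).

Definition degenerate (R : realType) (k m : nat) (M : manifold R m)
    (sigma : 'rV[R]_k -> M) : Prop :=
  exists i : 'I_k, forall s t, unit_cube s -> unit_cube t ->
    (forall j, j != i -> s 0 j = t 0 j) -> sigma s = sigma t.

(* Vanishing in the normalised cubical chain complex. *)
Definition chain_null (R : realType) (k m : nat) (M : manifold R m)
    (c : chain M k) : Prop :=
  forall sigma, ~ degenerate sigma -> chain_mult c sigma = 0.

Definition chain_opp (R : realType) (k m : nat) (M : manifold R m)
    (c : chain M k) : chain M k :=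
  [seq (- p.1, p.2) | p : int * ('rV[R]_k -> M) <- c].

Definition face (R : realType) (k m : nat) (M : manifold R m) (i : 'I_k.+1)
    (e : R) (sigma : 'rV[R]_k.+1 -> M) : 'rV[R]_k -> M :=
  fun t => sigma (\row_j oapp (fun l => t 0 l) e (unlift i j)).

Definition boundary (R : realType) (k m : nat) (M : manifold R m)
    (c : chain M k.+1) : chain M k :=
  flatten [seq flatten
    [seq [:: ((-1) ^+ i * p.1, face i 1 p.2);
             (- ((-1) ^+ i * p.1), face i 0 p.2)] | i : 'I_k.+1 <- enum 'I_k.+1]
  | p : int * ('rV[R]_k.+1 -> M) <- c].

Definition chain_in (R : realType) (k m : nat) (M : manifold R m) (A : set M)
    (c : chain M k) : Prop :=
  all (fun p => `[< smooth_euclid p.2 /\ forall t, A (p.2 t) >]) c.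

Definition cycle_in (R : realType) (k m : nat) (M : manifold R m) (A : set M)
    (c : chain M k.+1) : Prop :=
  chain_in A c /\ chain_null (boundary c).

Definition homologous_in (R : realType) (k m : nat) (M : manifold R m)
    (A : set M) (c c' : chain M k) : Prop :=
  exists d : chain M k.+1,
    chain_in A d /\ chain_null (c ++ chain_opp (c' ++ boundary d)).

(* Pairing of a covector with a vector, both given by coordinates in the
   preferred chart. *)
Definition pairing (R : realType) (n : nat) (alpha v : 'rV[R]_n) : R :=
  \sum_(j < n) alpha 0 j * v 0 j.

(* H_1(X_b, Z) as a subset of T_b^* B. *)
Definition Lambda (R : realType) (n : nat) (X : calabi_yau R n)
    (B : manifold R n) (f : X -> B) (b : B) : set 'rV[R]_n :=
  [set alpha | exists c : chain X 1, cycle_in (f @^-1` [set b]) c /\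
    forall v, pairing alpha v = - int_chain c (contract f v (omega X))].

(* H^1(X_b, Z) as a subset of T_b B. *)
Definition dual_lattice (R : realType) (n : nat) (X : calabi_yau R n)
    (B : manifold R n) (f : X -> B) (b : B) : set 'rV[R]_n :=
  [set v | forall lambda, Lambda f b lambda -> pairing lambda v \is a Num.int].

(* t |-> Phi (\sum_i t_i a_i), with a_i the i-th row of A. *)
Definition torus_cube (R : realType) (n k m : nat) (M : manifold R m)
    (Phi : 'rV[R]_n -> M) (A : 'M[R]_(k, n)) : 'rV[R]_k -> M :=
  fun t => Phi (t *m A).

(* The identification X_b = T_b^* B / Lambda determined by the origin [Phi 0],
   with an oriented basis of Lambda (the rows of [basis]). By [Phi_flow] each
   curve s |-> Phi (alpha + s beta) is an integral curve of the field v_beta with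
   iota(v_beta) omega = f^* beta, so that its time-one flow sends [Phi alpha] to
   [Phi (alpha + beta)]. *)
Record marking (R : realType) (n : nat) (X : calabi_yau R n)
    (B : manifold R n) (f : X -> B) (b : B) := Marking {
  Phi : 'rV[R]_n -> X;
  Phi_smooth : smooth_euclid Phi;
  Phi_range : range Phi = f @^-1` [set b];
  Phi_periods : forall alpha beta,
    Phi alpha = Phi beta <-> Lambda f b (alpha - beta);
  Phi_flow : forall alpha beta u,
    omega X (Phi alpha) (pair2 (tangent_euclid Phi alpha beta) u) =
    pairing beta (tangent_map f (Phi alpha) u);
  basis : 'M[R]_n;
  basis_free : basis \in unitmx;
  basis_span : forall alpha, Lambda f b alpha <->
    exists k : 'rV[int]_n, alpha = map_mx intr k *m basis;
  basis_oriented : forall t,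
    0 < pullback (torus_cube Phi basis) (re_form (Omega X)) t
          (fun i : 'I_n => delta_mx 0 i) }.
Arguments Phi {R n X B f b} m _.
Arguments basis {R n X B f b} m.

(* Integral over X_b, oriented by Re Omega, computed on the fundamental
   parallelepiped of T_b^* B / Lambda spanned by the oriented basis. *)
Definition fibre_integral (R : realType) (n : nat) (X : calabi_yau R n)
    (B : manifold R n) (f : X -> B) (b : B) (D : marking f b)
    (theta : form R X n) : R :=
  int_cube (torus_cube (Phi D) (basis D)) theta.

Definition fibre_period (R : realType) (n : nat) (X : calabi_yau R n)
    (B : manifold R n) (f : X -> B) (b : B) (D : marking f b) : complex R :=
  Complex (fibre_integral D (re_form (Omega X)))
          (fibre_integral D (im_form (Omega X))).

Definition Omega_n (R : realType) (n : nat) (X : calabi_yau R n)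
    (B : manifold R n) (f : X -> B) (b : B) (D : marking f b) :
    form (complex R) X n :=
  fun x w => Omega X x w / fibre_period D.

(* From here on the complex dimension is n.+1. *)

Definition h (R : realType) (n : nat) (X : calabi_yau R n.+1)
    (B : manifold R n.+1) (f : X -> B) (b : B) (D : marking f b)
    (v w : 'rV[R]_n.+1) : R :=
  - fibre_integral D
      (wedge (contract f v (omega X))
             (contract f w (im_form (Omega X)))).

(* [fibre_period D] is real, as Im Omega vanishes on X_b. *)
Definition h_n (R : realType) (n : nat) (X : calabi_yau R n.+1)
    (B : manifold R n.+1) (f : X -> B) (b : B) (D : marking f b)
    (v w : 'rV[R]_n.+1) : R :=
  h D v w / complex.Re (fibre_period D).

(* The chain c represents the class in H_n(X_b, Z) = \bigwedge^n Lambda of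
   gamma = \sum_i a_i e_i^*, where e_i^* corresponds (with i counted from 0) to
   (-1)^i e_0 /\ .. /\ e_n with e_i omitted, the class of a subtorus of X_b. *)
Definition represents (R : realType) (n : nat) (X : calabi_yau R n.+1)
    (B : manifold R n.+1) (f : X -> B) (b : B) (D : marking f b)
    (c : chain X n) (gamma : 'rV[R]_n.+1) : Prop :=
  chain_in (f @^-1` [set b]) c /\
  exists a : 'I_n.+1 -> int,
    (forall i, (a i)%:~R = pairing (row i (basis D)) gamma) /\
    homologous_in (f @^-1` [set b]) c
      [seq ((-1) ^+ i * a i,
            torus_cube (Phi D) (row' i (basis D)))
      | i : 'I_n.+1 <- enum 'I_n.+1].

(* The 1-form v |-> - \int_c iota(v) Im Omega_n. *)
Definition period_form (R : realType) (n : nat) (X : calabi_yau R n.+1)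
    (B : manifold R n.+1) (f : X -> B) (b : B) (D : marking f b)
    (c : chain X n) : 'rV[R]_n.+1 -> R :=
  fun v => - int_chain c (contract f v (im_form (Omega_n D))).

(* Sections over U of R^1 f_* Z embedded in the sheaf of vector fields. *)
Definition R1_section (R : realType) (n : nat) (X : calabi_yau R n)
    (B : manifold R n) (f : X -> B) (U : set B) (s : B -> 'rV[R]_n) : Prop :=
  smooth_vector_field U s /\ forall b, U b -> dual_lattice f b (s b).

(* Main.v *)
(* Put beta = Im Omega, and let eta_v be the contraction of beta with a lift of v,
   restricted to X_b. In the flow coordinates on X_b = T_b^* B / Lambda the 1-form
   iota(gamma) omega is the constant form - gamma, and
   gamma = \sum_i a_i e_i^* with a_i = gamma (e_i), so that h (gamma, v) is the integral
   over the fundamental parallelepiped of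
   \sum_i (-1)^i a_i eta_v (e_0, .., e_i omitted, .., e_n).
   If eta_v is closed, Stokes' theorem and the periodicity make the integral of the i-th
   term over the slices "t_i constant" independent of t_i; hence the i-th integral is that
   of eta_v over the subtorus spanned by the e_j with j != i, and the sum is the integral
   of eta_v over the cycle dual to gamma. Stokes' theorem again gives independence of the
   chosen representative of that cycle.
   To see that eta_v is closed, extend v to a vector field on B that is constant in a chart
   and lift it to a field Z near the fibre. Since d beta = 0, d (i_Z beta) is the Lie
   derivative of beta along Z, which vanishes on vertical vectors because beta vanishes on
   all nearby fibres and the bracket of Z with a vertical field is vertical. Finally
   d Omega = 0 because Omega is holomorphic of top degree. *)
From mathcomp Require Import all_boot all_order all_algebra all_fingroup.
From mathcomp Require Import complex ring.
From mathcomp Require Import all_classical all_reals all_analysis.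
Require Import Defs.

Set Implicit Arguments.
Unset Strict Implicit.
Unset Printing Implicit Defensive.

Import Order.TTheory GRing.Theory Num.Theory numFieldNormedType.Exports.
Local Open Scope classical_set_scope.
Local Open Scope ring_scope.

(** * Iterated integrals over the cube *)

(** The fibre is never given a manifold structure of its own. Closedness of eta_v is stated as an
    identity between coefficients along smooth maps g from R^k into X_b, and this one form serves
    the flow parallelepiped, its rescalings and the filling cubes of a homology. The obstacle is
    that [contract] picks a lift of v separately at every point, with no continuity. As Im Omega
    vanishes on vertical vectors, the coefficients do not see this choice, and near a point it may
    be replaced by a C^1 lift built from a local section of the differential of f. The Lie
    derivative argument then becomes a computation in one chart: Leibniz rule, symmetry of second
    derivatives, antisymmetry. A second obstacle is that chains are compared only on the unit cube
    and modulo degenerate cubes, while cubes are maps on all of R^k; the integral has to respect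
    both relations, boundary points included. As for the sign, the minus in iota(gamma) omega = -
    gamma cancels the minus in [h], so the sign that survives is the one in [period_form]. *)

Lemma continuous_pair (T U V : topologicalType) (f : T -> U) (g : T -> V) :
  continuous f -> continuous g -> continuous (fun x => (f x, g x)).
Proof. by move=> cf cg x; apply: cvg_pair; [exact: cf|exact: cg]. Qed.

Lemma continuous_compose (T U V : topologicalType) (f : T -> U) (g : U -> V) :
  continuous f -> continuous g -> continuous (fun x => g (f x)).
Proof. by move=> cf cg x; apply: (continuous_comp (cf x)); exact: cg. Qed.

Section Integral.
Context {R : realType}.
Notation mu := (@lebesgue_measure R).
Implicit Types g : R -> R.

Lemma integrable_unit g : continuous g -> mu.-integrable `[0, 1] (EFin \o g).
Proof.
move=> cg; apply: continuous_compact_integrable; first exact: segment_compact.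
exact: continuous_subspaceT.
Qed.

(** Compactness of the unit interval makes the convergence of [h x] to [h x0] uniform in t. The
    parameter space is arbitrary because iterated integration adjoins the remaining cube variables
    to it. *)
Lemma continuous_unit_integral (T : topologicalType) (h : T -> R -> R) :
  continuous (fun p : T * R => h p.1 p.2) ->
  continuous (fun x => \int[mu]_(t in `[0, 1]) h x t).
Proof.
move=> ch x0.
have chx x : continuous (h x).
  apply: (@continuous_compose _ _ _ (fun t => (x, t)) (fun p => h p.1 p.2)) ch.
  by apply: continuous_pair => t; [exact: cvg_cst|exact: cvg_id].
apply/cvgrPdist_le => e e0.
have K : \forall x \near x0, `[0, 1]%classic `<=` (fun t => `|h x0 t - h x t| <= e).
  have /compact_near_coveringP := @segment_compact R 0 1.
  apply => t _.
  have := ch (x0, t); move/cvgrPdist_lt => /(_ (e / 2)).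
  have e20 : 0 < e / 2 by rewrite divr_gt0.
  move=> /(_ e20) [[A B]/= [nA nB] AB].
  exists (B, A) => //= -[t' x'] /= [Bt' Ax'].
  have h1 : `|h x0 t - h x' t'| < e / 2 by apply: (AB (x', t')).
  have h2 : `|h x0 t - h x0 t'| < e / 2.
    by apply: (AB (x0, t')); split => //=; exact: nbhs_singleton.
  rewrite -(subrKA (h x0 t)) (le_trans (ler_normD _ _))// (splitr e).
  by rewrite lerD// ltW// distrC.
near=> x.
have xK : `[0, 1]%classic `<=` (fun t => `|h x0 t - h x t| <= e) by near: x.
rewrite -RintegralB//; [|exact: integrable_unit..].
have cB : continuous (fun t => h x0 t - h x t).
  by move=> t; apply: cvgB; exact: chx.
apply: (le_trans (le_normr_Rintegral _ (integrable_unit cB))) => //.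
have -> : e = \int[mu]_(t in `[0, 1]) (cst e t).
  by rewrite Rintegral_cst//= lebesgue_measure_itv/= lte01 oppr0 adde0 mulr1.
apply: le_Rintegral => //; apply: integrable_unit.
  by move=> t; apply: cvg_norm; exact: cB.
by move=> t; exact: cvg_cst.
Unshelve. all: by end_near. Qed.

Lemma unit_integral_derive (F f : R -> R) :
  (forall x : R, is_derive x (1 : R) F (f x)) -> continuous f ->
  \int[mu]_(t in `[0, 1]) f t = F 1 - F 0.
Proof.
move=> dF cf; rewrite /Rintegral (@continuous_FTC2 _ f F 0 1)//.
- exact: continuous_subspaceT.
- have cF : continuous F.
    by move=> x; apply/differentiable_continuous/derivable1_diffP.
  split; first by move=> x _; exact: ex_derive.
  + exact/cvg_at_right_filter/cF.
  + exact/cvg_at_left_filter/cF.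
- by move=> x _; rewrite derive1E; exact: derive_val.
Qed.

(** The product sigma-algebra is generated by rectangles; an open set of the plane belongs to it
    because it is a countable union of boxes with rational corners. *)
Lemma continuous_measurable_prod (g : R * R -> R) :
  continuous g -> measurable_fun setT g.
Proof.
move=> cg.
apply: (measurability _ (measurable_realfun.RGenOpens.measurableE R)) => _ [_ [a [b ->] <-]].
have oO : open `]a, b[%classic by exact: interval_open.
move: oO; set O := `]a, b[%classic => oO.
rewrite setTI.
pose box (r : (rat * rat) * (rat * rat)) : set (R * R) :=
  `]ratr r.1.1, ratr r.1.2[%classic `*` `]ratr r.2.1, ratr r.2.2[%classic.
have -> : g @^-1` O = \bigcup_(r in [set r | box r `<=` g @^-1` O]) box r.
  apply/seteqP; split => [[x y] Oxy|x [r /= rO rx]]; last exact: rO.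
  have : nbhs (x, y) (g @^-1` O) by apply: cg; exact: open_nbhs_nbhs.
  move=> [[A B]/= [nA nB] AB].
  have ratbox (z : R) (C : set R) : nbhs z C -> exists r : rat * rat,
      `]ratr r.1, ratr r.2[%classic z /\ `]ratr r.1, ratr r.2[%classic `<=` C.
    move=> /nbhs_ballP[e /= e0 zC].
    have /rat_in_itvoo[p hp] : z - e < z by rewrite ltrBlDr ltrDl.
    have /rat_in_itvoo[q hq] : z < z + e by rewrite ltrDl.
    move: hp hq; rewrite !in_itv/= => /andP[p1 p2] /andP[q1 q2].
    exists (p, q); split; first by rewrite /= in_itv/= p2 q1.
    move=> w; rewrite /= in_itv/= => /andP[pw wq]; apply: zC.
    by rewrite /ball/= distrC ltr_distl (lt_trans p1)//= (lt_trans wq).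
  have [r1 [r1x r1A]] := ratbox _ _ nA; have [r2 [r2y r2B]] := ratbox _ _ nB.
  exists (r1, r2) => //= -[u v] [/= /r1A Au /r2B Bv]; exact: (AB (u, v)).
rewrite bigcup_mkcond; apply: countable_bigcupT_measurable => // r.
by case: ifP => // _; apply: measurableX; exact: measurable_itv.
Qed.

Lemma unit_integral_swap (g : R -> R -> R) :
  continuous (fun p : R * R => g p.1 p.2) ->
  \int[mu]_(s in `[0, 1]) \int[mu]_(t in `[0, 1]) g s t =
  \int[mu]_(t in `[0, 1]) \int[mu]_(s in `[0, 1]) g s t.
Proof.
move=> cg.
pose I : set R := `[0, 1]%classic.
(* Extending g by zero outside the square brings the integrals to the whole plane, where [Fubini]
   applies; integrability comes from boundedness on the compact square. *)
pose f : R * R -> \bar R := (fun p => (g p.1 p.2)%:E) \_ (I `*` I).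
have mI : measurable I by exact: measurable_itv.
have cg1 s : continuous (g s).
  apply: (@continuous_compose _ _ _ (fun t => (s, t)) (fun p => g p.1 p.2)) cg.
  by apply: continuous_pair => t; [exact: cvg_cst|exact: cvg_id].
have cg2 t : continuous (g ^~ t).
  apply: (@continuous_compose _ _ _ (fun s => (s, t)) (fun p => g p.1 p.2)) cg.
  by apply: continuous_pair => s; [exact: cvg_id|exact: cvg_cst].
have cI1 : continuous (fun s => \int[mu]_(t in I) g s t).
  exact: continuous_unit_integral.
have cI2 : continuous (fun t => \int[mu]_(s in I) g s t).
  apply: (@continuous_unit_integral _ (fun t s => g s t)).
  apply: (@continuous_compose _ _ _ (fun p : R * R => (p.2, p.1)) (fun p => g p.1 p.2)) cg.
  by apply: continuous_pair => ?; [exact: cvg_snd|exact: cvg_fst].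
have fint : (mu \x mu)%E.-integrable setT f.
  suff : (mu \x mu)%E.-integrable (I `*` I) (EFin \o (fun p : R * R => g p.1 p.2)).
    by move/integrable_mkcond; apply; exact: measurableX.
  apply: measurable_bounded_integrable.
  - exact: measurableX.
  - have e := @product_measure1E _ _ _ _ R mu mu I I mI mI.
    apply: (@le_lt_trans _ _ (mu I * mu I)%E); first by rewrite -e.
    by rewrite /I !lebesgue_measure_itv/= lte01 oppr0 adde0 mule1 ltry.
  - apply: measurable_funTS; exact: continuous_measurable_prod.
  - have cK : compact (I `*` I) by apply: compact_setX; exact: segment_compact.
    have := continuous_compact (continuous_subspaceT cg) cK.
    move/compact_bounded => [M [_ mrt]].
    exists M; split; rewrite ?num_real// => M' MM' p Kp.
    by apply: (mrt M' MM'); exists p.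
have := Fubini fint.
have -> : (\int[mu]_x \int[mu]_y f (x, y) =
    \int[mu]_(x in I) (\int[mu]_(y in I) g x y)%:E)%E.
  rewrite [RHS]integral_mkcond; apply: eq_integral => x _.
  rewrite /f /patch; case: ifPn => xI.
    rewrite fineK; last exact/integrable_fin_num/integrable_unit.
    rewrite [RHS]integral_mkcond; apply: eq_integral => y _.
    by rewrite /patch in_setX/= xI.
  by apply: integral0_eq => y _; rewrite in_setX/= (negbTE xI).
have -> : (\int[mu]_y \int[mu]_x f (x, y) =
    \int[mu]_(y in I) (\int[mu]_(x in I) g x y)%:E)%E.
  rewrite [RHS]integral_mkcond; apply: eq_integral => y _.
  rewrite /f /patch; case: ifPn => yI.
    rewrite fineK; last exact/integrable_fin_num/integrable_unit.
    rewrite [RHS]integral_mkcond; apply: eq_integral => x _.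
    by rewrite /patch in_setX/= yI andbT.
  by apply: integral0_eq => x _; rewrite in_setX/= (negbTE yI) andbF.
by move=> h; rewrite /Rintegral; congr fine.
Qed.

End Integral.

Lemma continuous_mx (R : realType) (T : topologicalType) m n (M : T -> 'M[R]_(m, n)) :
  (forall i j, continuous (fun x => M x i j)) -> continuous M.
Proof.
move=> cM x; apply/cvgrPdist_le => /= e e0; near=> y.
rewrite /Num.Def.normr/= mx_normrE (bigmax_le _ (ltW e0))//= => i _.
rewrite !mxE; move: i; near: y; apply: filter_forall => /= i.
exact: ((cvgrPdist_le _ _).1 (cM i.1 i.2 x)).
Unshelve. all: by end_near. Qed.

Lemma continuous_entry (R : realType) (T : topologicalType) m n (M : T -> 'M[R]_(m, n)) i j :
  continuous M -> continuous (fun x => M x i j).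
Proof. by move=> cM; exact: (continuous_compose cM (@coord_continuous _ _ _ i j)). Qed.

(* [face i e g t] is convertible to [g (ins i e t)]. *)
Definition ins (R : realType) (k : nat) (i : 'I_k.+1) (s : R) (y : 'rV[R]_k) :
    'rV[R]_k.+1 :=
  \row_j oapp (fun l => y 0 l) s (unlift i j).

Section DeriveAffine.
Context {R : realType} {U V W : normedModType R}.

(** Both sides are limits of one and the same difference quotient, so the rule can be iterated
    inside [iter_derive] without tracking differentiability. *)
Lemma derive_affine (f : V -> W) (a : U -> V) (x v : U) (w : V) :
  (forall h : R, a (h *: v + x) = h *: w + a x) ->
  'D_v (fun y => f (a y)) x = 'D_w f (a x).
Proof. by move=> ha; rewrite /derive; under eq_fun do rewrite /= ha. Qed.

Lemma derivable_affine (f : V -> W) (a : U -> V) (x v : U) (w : V) :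
  (forall h : R, a (h *: v + x) = h *: w + a x) ->
  derivable f (a x) w -> derivable (fun y => f (a y)) x v.
Proof. by move=> ha; rewrite /derivable; under [in X in _ -> X]eq_fun do rewrite /= ha. Qed.

End DeriveAffine.

(** * Slices of cubes and the fundamental theorem of calculus in one coordinate *)

Section Cube.
Context {R : realType}.
Notation mu := (@lebesgue_measure R).

Lemma ins_lift k (i : 'I_k.+1) (s : R) y l : ins i s y 0 (lift i l) = y 0 l.
Proof. by rewrite mxE liftK. Qed.

Lemma ins_self k (i : 'I_k.+1) (s : R) y : ins i s y 0 i = s.
Proof. by rewrite mxE unlift_none. Qed.

Lemma continuous_ins (T : topologicalType) k (i : 'I_k.+1) (s : T -> R) (y : T -> 'rV[R]_k) :
  continuous s -> continuous y -> continuous (fun x => ins i (s x) (y x)).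
Proof.
move=> cs cy; apply: continuous_mx => a j; rewrite ord1.
case: (unliftP i j) => [l|] ->.
  by under eq_fun do rewrite ins_lift; exact: continuous_entry.
by under eq_fun do rewrite ins_self.
Qed.

Lemma ins_comm k (i : 'I_k.+1) (s t : R) (y : 'rV[R]_k) :
  ins ord0 t (ins i s y) = ins (lift ord0 i) s (ins ord0 t y).
Proof.
apply/rowP => j; case: (unliftP ord0 j) => [l|] ->.
  rewrite ins_lift; case: (unliftP i l) => [l'|] ->.
    rewrite ins_lift.
    have -> : lift ord0 (lift i l') = lift (lift ord0 i) (lift ord0 l').
      by apply: val_inj; rewrite /= /bump/= !add1n ltnS; case: leqP.
    by rewrite !ins_lift.
  by rewrite !ins_self.
rewrite ins_self.
have -> : ord0 = lift (lift ord0 i) ord0 :> 'I_k.+2.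
  by apply: val_inj.
by rewrite ins_lift ins_self.
Qed.

Lemma cube_integralS k (g : 'rV[R]_k.+1 -> R) :
  cube_integral g =
  \int[mu]_(t in `[0, 1]) cube_integral (fun y => g (ins ord0 t y)).
Proof. by []. Qed.

Lemma continuous_cube_integral k (T : topologicalType) (g : T -> 'rV[R]_k -> R) :
  continuous (fun p : T * 'rV[R]_k => g p.1 p.2) ->
  continuous (fun x => cube_integral (g x)).
Proof.
elim: k T g => [|k IH] T g cg.
  apply: (@continuous_compose _ _ _ (fun x => (x, 0 : 'rV[R]_0))) cg.
  by apply: continuous_pair => x; [exact: cvg_id|exact: cvg_cst].
apply: (@continuous_unit_integral _ _
  (fun x t => cube_integral (fun y => g x (ins ord0 t y)))).
apply: (IH (T * R)%type (fun p y => g p.1 (ins ord0 p.2 y))).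
apply: (@continuous_compose _ _ _
  (fun p : (T * R) * 'rV[R]_k => (p.1.1, ins ord0 p.1.2 p.2))
  (fun p : T * 'rV[R]_k.+1 => g p.1 p.2)) => //.
have c1 : continuous (@fst (T * R)%type 'rV[R]_k) by move=> ?; exact: cvg_fst.
apply: continuous_pair.
  by apply: (continuous_compose c1) => ?; exact: cvg_fst.
apply: continuous_ins; last by move=> ?; exact: cvg_snd.
by apply: (continuous_compose c1) => ?; exact: cvg_snd.
Qed.

Lemma continuous_cube_slice k (i : 'I_k.+1) (g : 'rV[R]_k.+1 -> R) :
  continuous g -> continuous (fun s => cube_integral (fun y => g (ins i s y))).
Proof.
move=> cg; apply: (@continuous_cube_integral k R (fun s y => g (ins i s y))).
apply: (@continuous_compose _ _ _ (fun p : R * 'rV[R]_k => ins i p.1 p.2)) cg.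
by apply: continuous_ins => ?; [exact: cvg_fst|exact: cvg_snd].
Qed.

Lemma continuous_insr k (i : 'I_k.+1) s (g : 'rV[R]_k.+1 -> R) :
  continuous g -> continuous (fun y => g (ins i s y)).
Proof.
apply: (@continuous_compose _ _ _ (fun y => ins i s y)).
apply: (@continuous_ins _ _ _ (cst s) id) => ?; first exact: cst_continuous.
exact: cvg_id.
Qed.

Lemma unit_cube_ins k (i : 'I_k.+1) s (y : 'rV[R]_k) :
  0 <= s <= 1 -> @unit_cube R k y -> unit_cube (ins i s y).
Proof.
by move=> hs hy j; case: (unliftP i j) => [l|] ->; rewrite ?ins_lift ?ins_self.
Qed.

Lemma eq_cube_integral k (f g : 'rV[R]_k -> R) :
  {in @unit_cube R k, f =1 g} -> cube_integral f = cube_integral g.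
Proof.
elim: k f g => [|k IH] f g fg; first by apply: fg; rewrite inE => -[].
apply: eq_Rintegral => t; rewrite inE/= in_itv/= => t01.
apply: IH => y; rewrite inE => hy; apply: fg; rewrite inE.
exact: (unit_cube_ins ord0).
Qed.

Lemma cube_integralD k (f g : 'rV[R]_k -> R) : continuous f -> continuous g ->
  cube_integral (fun t => f t + g t) = cube_integral f + cube_integral g.
Proof.
elim: k f g => [|k IH] f g cf cg //; rewrite !cube_integralS.
rewrite -RintegralD//; [|exact/integrable_unit/continuous_cube_slice..].
by apply: eq_Rintegral => t _; rewrite IH//; exact: continuous_insr.
Qed.

Lemma cube_integralZ k (a : R) (f : 'rV[R]_k -> R) : continuous f ->
  cube_integral (fun t => a * f t) = a * cube_integral f.
Proof.
elim: k f => [|k IH] f cf //; rewrite !cube_integralS.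
rewrite -RintegralZl//; last exact/integrable_unit/continuous_cube_slice.
by apply: eq_Rintegral => t _; rewrite IH//; exact: continuous_insr.
Qed.

Lemma cube_integral_cst k (a : R) : cube_integral (fun _ : 'rV[R]_k => a) = a.
Proof.
elim: k => // k IH; rewrite cube_integralS.
under eq_Rintegral do rewrite IH.
by rewrite Rintegral_cst//= lebesgue_measure_itv/= lte01 oppr0 adde0 mulr1.
Qed.

Lemma cube_integral_sum k (I : Type) (r : seq I) (a : I -> R) (F : I -> 'rV[R]_k -> R) :
  (forall i, continuous (F i)) ->
  cube_integral (fun t => \sum_(i <- r) a i * F i t) =
  \sum_(i <- r) a i * cube_integral (F i).
Proof.
move=> cF.
have cZ i : continuous (fun t => a i * F i t).
  by move=> t; exact: (cvgM (@cst_continuous _ _ (a i) t) (cF i t)).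
have cS r' : continuous (fun t => \sum_(i <- r') a i * F i t).
  elim: r' => [|i r' IH].
    by under eq_fun do rewrite big_nil; exact: cst_continuous.
  by under eq_fun do rewrite big_cons; move=> t; exact: (cvgD (cZ i t) (IH t)).
elim: r => [|i r IH].
  under eq_fun do rewrite big_nil.
  by rewrite big_nil cube_integral_cst.
under eq_fun do rewrite big_cons.
by rewrite big_cons cube_integralD ?IH ?cube_integralZ.
Qed.

(** [cube_integral] integrates coordinate 0 outermost. Inductively, coordinate l of the remaining
    ones is brought next to it, and [unit_integral_swap] exchanges the two. *)
Lemma cube_integral_slice k (i : 'I_k.+1) (g : 'rV[R]_k.+1 -> R) :
  continuous g ->
  cube_integral g = \int[mu]_(s in `[0, 1]) cube_integral (fun y => g (ins i s y)).
Proof.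
elim: k i g => [|k IH] i g cg; first by rewrite ord1.
case: (unliftP ord0 i) => [l|] ->; last exact: cube_integralS.
transitivity (\int[mu]_(t in `[0, 1]) \int[mu]_(s in `[0, 1])
    cube_integral (fun z => g (ins ord0 t (ins l s z)))).
  by rewrite cube_integralS; apply: eq_Rintegral => t _; rewrite (IH l)//; exact: continuous_insr.
rewrite unit_integral_swap.
  apply: eq_Rintegral => s _; rewrite cube_integralS; apply: eq_Rintegral => t _.
  by apply: eq_cube_integral => y _; rewrite ins_comm.
apply: (@continuous_cube_integral _ _ (fun p z => g (ins ord0 p.1 (ins l p.2 z)))).
apply: (@continuous_compose _ _ _
  (fun p : (R * R) * 'rV[R]_k => ins ord0 p.1.1 (ins l p.1.2 p.2))) cg.
have c1 : continuous (@fst (R * R)%type 'rV[R]_k) by move=> ?; exact: cvg_fst.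
apply: continuous_ins.
  by apply: (continuous_compose c1) => ?; exact: cvg_fst.
apply: continuous_ins; last by move=> ?; exact: cvg_snd.
by apply: (continuous_compose c1) => ?; exact: cvg_snd.
Qed.

Lemma cube_integral_swap k (g : R -> 'rV[R]_k -> R) :
  continuous (fun p : R * 'rV[R]_k => g p.1 p.2) ->
  \int[mu]_(s in `[0, 1]) cube_integral (g s) =
  cube_integral (fun y => \int[mu]_(s in `[0, 1]) g s y).
Proof.
elim: k g => [//|k IH] g cg.
have c1 : continuous (@fst (R * R)%type 'rV[R]_k) by move=> ?; exact: cvg_fst.
rewrite unit_integral_swap.
  rewrite cube_integralS; apply: eq_Rintegral => t _.
  apply: (IH (fun s y => g s (ins ord0 t y))).
  apply: (@continuous_compose _ _ _ (fun p : R * 'rV[R]_k => (p.1, ins ord0 t p.2))) cg.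
  apply: continuous_pair => [?|]; first exact: cvg_fst.
  by apply: (@continuous_ins _ _ _ (cst t)) => ?; [exact: cst_continuous|exact: cvg_snd].
apply: (@continuous_cube_integral _ _ (fun p z => g p.1 (ins ord0 p.2 z))).
apply: (@continuous_compose _ _ _ (fun p : (R * R) * 'rV[R]_k => (p.1.1, ins ord0 p.1.2 p.2))) cg.
apply: continuous_pair.
  by apply: (continuous_compose c1) => ?; exact: cvg_fst.
apply: continuous_ins; last by move=> ?; exact: cvg_snd.
by apply: (continuous_compose c1) => ?; exact: cvg_snd.
Qed.

Lemma ins_affine k (i : 'I_k.+1) (y : 'rV[R]_k) (s h : R) :
  ins i (h *: (1 : R) + s) y = h *: delta_mx 0 i + ins i s y.
Proof.
apply/rowP => j; rewrite !mxE eqxx /=; case: (unliftP i j) => [l|] ->.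
  by rewrite eq_sym (negbTE (neq_lift i l)) mulr0 add0r.
by rewrite eqxx mulr1 -[h *: 1]/(h * 1) mulr1.
Qed.

(** The i-th coordinate is first made outermost and then innermost, where the one-variable theorem
    applies on each line parallel to the i-th axis. *)
Lemma cube_integral_derive k (i : 'I_k.+1) (g : 'rV[R]_k.+1 -> R) :
  continuous g -> (forall t, derivable g t (delta_mx 0 i)) ->
  continuous ('D_(delta_mx 0 i) g) ->
  cube_integral ('D_(delta_mx 0 i) g) =
  cube_integral (fun y => g (ins i 1 y)) - cube_integral (fun y => g (ins i 0 y)).
Proof.
move=> cg dg cdg; rewrite (cube_integral_slice i)// cube_integral_swap; last first.
  apply: (@continuous_compose _ _ _ (fun p : R * 'rV[R]_k => ins i p.1 p.2)) cdg.
  by apply: continuous_ins => ?; [exact: cvg_fst|exact: cvg_snd].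
rewrite -[X in _ = _ + X]mulN1r -cube_integralZ; last exact: continuous_insr.
rewrite -cube_integralD; [|exact: continuous_insr|]; last first.
  have c0 : continuous (fun y => g (ins i 0 y)) by exact: continuous_insr.
  by move=> t; exact: (cvgM (@cst_continuous _ _ (-1 : R) t) (c0 t)).
apply: eq_cube_integral => y _; rewrite mulN1r.
apply: (@unit_integral_derive _ (fun s => g (ins i s y))).
  move=> s; apply: DeriveDef.
    exact: (derivable_affine (ins_affine i y s)).
  exact: (derive_affine _ (ins_affine i y s)).
apply: (@continuous_compose _ _ _ (fun s => ins i s y)) cdg.
by apply: (@continuous_ins _ _ _ id (cst y)) => ?; [exact: cvg_id|exact: cst_continuous].
Qed.

End Cube.

(** * Alternating multilinear forms *)

Section Update.
Context {T : Type}.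

Lemma update_same k (w : 'I_k -> T) i u : update w i u i = u.
Proof. by rewrite /update eqxx. Qed.

Lemma update_neq k (w : 'I_k -> T) i j u : j != i -> update w i u j = w j.
Proof. by rewrite /update => /negbTE ->. Qed.

Lemma update_id k (w : 'I_k -> T) i : update w i (w i) = w.
Proof. by apply/funext => j; rewrite /update; case: eqP => // ->. Qed.

Lemma update_comm k (w : 'I_k -> T) i j u v : i != j ->
  update (update w i u) j v = update (update w j v) i u.
Proof.
move=> ij; apply/funext => l; rewrite /update.
by case: (eqVneq l j) => // ->; rewrite eq_sym (negbTE ij).
Qed.

Lemma update_comp k l (w : 'I_k -> T) (phi : 'I_l -> 'I_k) i u : injective phi ->
  (fun j => update w (phi i) u (phi j)) = update (fun j => w (phi j)) i u.
Proof. by move=> inj; apply/funext => j; rewrite /update (inj_eq inj). Qed.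

Lemma update_lift k (w : 'I_k.+1 -> T) i u :
  (fun j => update w i u (lift i j)) = (fun j => w (lift i j)).
Proof. by apply/funext => j; rewrite update_neq// eq_sym neq_lift. Qed.

Lemma fcons0 k (u : T) (w : 'I_k -> T) : fcons u w ord0 = u.
Proof. by rewrite /fcons unlift_none. Qed.

Lemma fcons_lift k (u : T) (w : 'I_k -> T) j : fcons u w (lift ord0 j) = w j.
Proof. by rewrite /fcons liftK. Qed.

Lemma fcons_eta k (w : 'I_k.+1 -> T) : fcons (w ord0) (fun j => w (lift ord0 j)) = w.
Proof. by apply/funext => j; case: (unliftP ord0 j) => [l|] ->; rewrite ?fcons_lift ?fcons0. Qed.

Lemma update_fcons0 k (u v : T) (w : 'I_k -> T) : update (fcons u w) ord0 v = fcons v w.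
Proof.
apply/funext => j; case: (unliftP ord0 j) => [l|] ->.
  by rewrite update_neq ?fcons_lift// eq_sym neq_lift.
by rewrite update_same fcons0.
Qed.

Lemma update_fcons_lift k (u v : T) (w : 'I_k -> T) i :
  update (fcons u w) (lift ord0 i) v = fcons u (update w i v).
Proof.
apply/funext => j; case: (unliftP ord0 j) => [l|] ->.
  by rewrite fcons_lift /update (inj_eq lift_inj) fcons_lift.
by rewrite update_neq ?fcons0// neq_lift.
Qed.

Lemma lift_liftE k (i : 'I_k.+1) (j : 'I_k) :
  lift (lift ord0 i) (lift ord0 j) = lift ord0 (lift i j).
Proof. by apply: val_inj; rewrite /= /bump/= !add1n ltnS; case: leqP. Qed.

End Update.

Section Multilinear.
Context {R : realType} {m : nat}.
Notation V := 'rV[R]_m.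

Definition multilinear k (a : ('I_k -> V) -> R) := forall w i (c : R) u v,
  a (update w i (c *: u + v)) = c * a (update w i u) + a (update w i v).

Definition alternating k (a : ('I_k -> V) -> R) := forall w i j, i != j -> w i = w j -> a w = 0.

Lemma multilinearD k (a : ('I_k -> V) -> R) w i u v : multilinear a ->
  a (update w i (u + v)) = a (update w i u) + a (update w i v).
Proof. by move=> ma; rewrite -[u]scale1r ma mul1r scale1r. Qed.

Lemma multilinear0 k (a : ('I_k -> V) -> R) w i : multilinear a ->
  a (update w i 0) = 0.
Proof.
move=> ma; have := multilinearD w i 0 0 ma; rewrite addr0 => /eqP.
by rewrite -subr_eq0 opprD addNKr oppr_eq0 => /eqP.
Qed.

Lemma multilinearZ k (a : ('I_k -> V) -> R) w i (c : R) u : multilinear a ->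
  a (update w i (c *: u)) = c * a (update w i u).
Proof. by move=> ma; rewrite -[c *: u]addr0 ma multilinear0// addr0. Qed.

Lemma multilinearN k (a : ('I_k -> V) -> R) w i u : multilinear a ->
  a (update w i (- u)) = - a (update w i u).
Proof. by move=> ma; rewrite -scaleN1r multilinearZ// mulN1r. Qed.

Lemma multilinearB k (a : ('I_k -> V) -> R) w i u v : multilinear a ->
  a (update w i (u - v)) = a (update w i u) - a (update w i v).
Proof. by move=> ma; rewrite multilinearD// multilinearN. Qed.

Lemma multilinear_sum k (a : ('I_k -> V) -> R) w i (I : Type) (r : seq I) (c : I -> R) u :
  multilinear a ->
  a (update w i (\sum_(j <- r) c j *: u j)) = \sum_(j <- r) c j * a (update w i (u j)).
Proof.
move=> ma; elim: r => [|j r IH]; first by rewrite !big_nil multilinear0.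
by rewrite !big_cons ma IH.
Qed.

Lemma multilinear_fcons k (a : ('I_k.+1 -> V) -> R) u : multilinear a ->
  multilinear (fun w => a (fcons u w)).
Proof. by move=> ma w i c x y; rewrite -!update_fcons_lift. Qed.

Lemma alternating_fcons k (a : ('I_k.+1 -> V) -> R) u : alternating a ->
  alternating (fun w => a (fcons u w)).
Proof.
move=> aa w i j ij wij; apply: (aa _ (lift ord0 i) (lift ord0 j)).
  by rewrite (inj_eq lift_inj).
by rewrite !fcons_lift.
Qed.

Lemma multilinear_basis k (a : ('I_k -> V) -> R) : multilinear a ->
  (forall f : 'I_k -> 'I_m, a (fun i => delta_mx 0 (f i)) = 0) -> forall w, a w = 0.
Proof.
elim: k a => [|k IH] a ma ha w.
  by rewrite -(ha (fun i => False_rect _ (notF (ltn_ord i)))); congr a; apply/funext => -[].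
rewrite -(fcons_eta w); move: (fun j => w (lift ord0 j)) => w'.
rewrite -(update_fcons0 0) [w ord0]row_sum_delta multilinear_sum// big1// => j _.
rewrite update_fcons0; apply/eqP; rewrite mulf_eq0; apply/orP; right; apply/eqP.
apply: (IH (fun w => a (fcons _ w))); first exact: multilinear_fcons.
move=> f; rewrite -(ha (fun i => oapp f j (unlift ord0 i))); congr a.
apply/funext => l; case: (unliftP ord0 l) => [l'|] ->.
  by rewrite fcons_lift.
by rewrite fcons0.
Qed.

Lemma alternating_tperm k (a : ('I_k -> V) -> R) w i j : multilinear a -> alternating a ->
  i != j -> a (fun l => w (tperm i j l)) = - a w.
Proof.
move=> ma aa ij.
(* Polarisation: expand [a] with x + y in both slots i and j, where the two diagonal terms
   vanish. *)
have E x y : a (update (update w i x) j y) = - a (update (update w i y) j x).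
  have z u : a (update (update w i u) j u) = 0.
    by apply: (aa _ i j ij); rewrite update_same update_neq// update_same.
  have := z (x + y); rewrite multilinearD// !(update_comm _ _ _ ij) !multilinearD//.
  rewrite -!(update_comm _ _ _ ij) !z add0r addr0 => /eqP.
  by rewrite addr_eq0 => /eqP ->; rewrite opprK.
have := E (w j) (w i).
have -> : update (update w i (w i)) j (w j) = w by rewrite update_id update_id.
move=> <-; congr a; apply/funext => l; rewrite /update.
case: tpermP => [->|->|/eqP li /eqP lj]; first by rewrite eqxx (negbTE ij).
  by rewrite eqxx.
by rewrite (negbTE li) (negbTE lj).
Qed.

Lemma alternating_perm k (a : ('I_k -> V) -> R) w (s : 'S_k) :
  multilinear a -> alternating a -> a (fun l => w (s l)) = (-1) ^+ s * a w.
Proof.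
move=> ma aa; have [ts -> dts] := prod_tpermP s.
elim: ts dts w => [_ w|t ts IH /= /andP[d dts] w].
  by rewrite big_nil odd_perm1 mul1r; congr a; apply/funext => l; rewrite perm1.
rewrite big_cons odd_permM odd_tperm d signr_addb -mulrA -IH// mulN1r.
rewrite -(alternating_tperm (fun l => w ((\prod_(u <- ts) tperm u.1 u.2)%g l)) ma aa d).
by congr a; apply/funext => l; rewrite permM.
Qed.

(** Bringing slot i to the front crosses the i slots before it; the permutation doing so is
    [lift_perm ord0 i 1], of parity i. *)
Lemma alternating_insert k (a : ('I_k.+1 -> V) -> R) (w : 'I_k.+1 -> V) (i : 'I_k.+1) z :
  multilinear a -> alternating a ->
  a (fcons z (fun j => w (lift i j))) = (-1) ^+ i * a (update w i z).
Proof.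
move=> ma aa; have := alternating_perm (update w i z) (lift_perm ord0 i 1) ma aa.
rewrite odd_lift_perm odd_perm1/= addbF signr_odd => <-; congr a.
apply/funext => j; case: (unliftP ord0 j) => [l|] ->.
  by rewrite fcons_lift lift_perm_lift perm1 update_neq// eq_sym neq_lift.
by rewrite fcons0 lift_perm_id update_same.
Qed.

End Multilinear.

(** * Sums over permutations and sums over an omitted index *)

Section PermSum.
Context {R : realType}.

(** A permutation of n + 1 letters is the image i of the first letter together with a permutation of
    the others. As B alternates in its second argument, the n! permutations with the same i
    contribute equally. This links the wedge product and the exterior derivative, as signed sums
    over one distinguished index, to sums over the whole symmetric group, where antisymmetry is a
    reindexing. *)
Lemma sum_perm_lift n (B : 'I_n.+1 -> ('I_n -> 'I_n.+1) -> R) :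
  (forall i phi (s : 'S_n), B i (fun j => phi (s j)) = (-1) ^+ s * B i phi) ->
  \sum_(s : 'S_n.+1) (-1) ^+ s * B (s ord0) (fun j => s (lift ord0 j)) =
  n`!%:R * \sum_(i < n.+1) (-1) ^+ i * B i (lift i).
Proof.
move=> hB; pose h (p : 'I_n.+1 * 'S_n) : 'S_n.+1 := lift_perm ord0 p.1 p.2.
have hinj : injective h.
  move=> [i s] [j t] /permP e; have := e ord0; rewrite /h !lift_perm_id /= => ij.
  rewrite -ij in e *; congr pair; apply/permP => l.
  by have := e (lift ord0 l); rewrite /h !lift_perm_lift => /lift_inj.
have hbij : bijective h.
  apply: inj_card_bij => //; rewrite card_prod card_ord.
  by rewrite [leqLHS]card_Sn [#|{: 'S_n}|]card_Sn factS.
rewrite (reindex h); last exact: onW_bij.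
rewrite -(pair_bigA _ (fun i (s : 'S_n) => (-1) ^+ h (i, s) * B (h (i, s) ord0)
  (fun j => h (i, s) (lift ord0 j)))) /= mulr_sumr.
apply: eq_bigr => i _.
transitivity (\sum_(s : 'S_n) (-1) ^+ i * B i (lift i)).
  apply: eq_bigr => s _; rewrite /h odd_lift_perm lift_perm_id /=.
  under [X in B _ X]funext do rewrite lift_perm_lift.
  by rewrite hB signr_addb signr_odd -mulrA signrMK.
by rewrite sumr_const [#|_|]card_Sn mulr_natl.
Qed.

(** With D u the derivative of a form in direction u, the sum is an exterior derivative, and this is
    its antisymmetry. Written over all permutations, it changes sign under composition with the
    transposition of i and j, while its terms are unchanged since w i = w j. *)
Lemma sum_omit_alternate n m (D : 'rV[R]_m -> ('I_n -> 'rV[R]_m) -> R)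
    (w : 'I_n.+1 -> 'rV[R]_m) i j :
  (forall u, multilinear (D u)) -> (forall u, alternating (D u)) ->
  i != j -> w i = w j ->
  \sum_(l < n.+1) (-1) ^+ l * D (w l) (fun r => w (lift l r)) = 0.
Proof.
move=> mD aD ij wij.
have wt l : w (tperm i j l) = w l by case: tpermP => [->|->|].
have := sum_perm_lift (B := fun l phi => D (w l) (fun r => w (phi r))).
move=> /(_ (fun l phi s => alternating_perm (fun r => w (phi r)) s (mD _) (aD _))) /=.
set S := (X in X = _) => hS.
have S0 : S = - S.
  rewrite {1}/S (reindex_inj (mulIg (tperm i j))) /= -sumrN; apply: eq_bigr => s _.
  rewrite odd_permM odd_tperm ij signr_addb mulrN1 permM wt !mulNr.
  by congr (- (_ * D _ _)); apply/funext => r; rewrite permM wt.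
have {}S0 : S = 0.
  by apply/eqP; have /eqP := S0; rewrite -subr_eq0 opprK -mulr2n mulrn_eq0.
by move: hS; rewrite S0 => /esym/eqP; rewrite mulf_eq0 pnatr_eq0 -leqn0 leqNgt fact_gt0 => /eqP.
Qed.

(** This is the cancellation behind the compatibility of d with pullback: S will hold the second
    derivatives of a parametrisation. Over all permutations, exchanging the omitted letter with the
    letter in slot l fixes S and reverses the sign. *)
Lemma sum_omit_symmetric n m (b : ('I_n -> 'rV[R]_m) -> R) (u : 'I_n.+1 -> 'rV[R]_m)
    (S : 'I_n.+1 -> 'I_n.+1 -> 'rV[R]_m) :
  multilinear b -> alternating b -> (forall i j, S i j = S j i) ->
  \sum_(i < n.+1) (-1) ^+ i *
    \sum_(l < n) b (update (fun r => u (lift i r)) l (S i (lift i l))) = 0.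
Proof.
move=> mb ab sS.
pose B i (phi : 'I_n -> 'I_n.+1) :=
  \sum_(l < n) b (update (fun r => u (phi r)) l (S i (phi l))).
have hB i phi (s : 'S_n) : B i (fun j => phi (s j)) = (-1) ^+ s * B i phi.
  rewrite /B [in RHS](reindex_inj (@perm_inj _ s)) mulr_sumr; apply: eq_bigr => l _.
  rewrite -(alternating_perm _ s mb ab); congr b.
  by rewrite (update_comp (fun r => u (phi r)) l (S i (phi (s l))) (@perm_inj _ s)).
have := sum_perm_lift hB; rewrite /B.
under eq_bigr do rewrite mulr_sumr.
rewrite exchange_big /= big1; last first.
  move=> l _; set X := (X in X = _).
  have X0 : X = - X.
    rewrite {1}/X (reindex_inj (mulgI (tperm ord0 (lift ord0 l)))) /= -sumrN.
    apply: eq_bigr => s _.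
    rewrite odd_permM odd_tperm (neq_lift ord0 l) addTb signrN mulNr.
    congr (- (_ * b _)); apply/funext => r; rewrite /update !permM tpermL tpermR sS.
    case: eqP => // /eqP rl; rewrite tpermD// ?neq_lift//.
    by rewrite (inj_eq lift_inj) eq_sym.
  by apply/eqP; have /eqP := X0; rewrite -subr_eq0 opprK -mulr2n mulrn_eq0.
by move=> /esym/eqP; rewrite mulf_eq0 pnatr_eq0 -leqn0 leqNgt fact_gt0 => /eqP.
Qed.


End PermSum.

(** * Differential calculus *)

Section C1.
Context {R : realType}.

(** Continuity of the derivatives is required at x only. This pointwise condition is easily shown
    stable under sums, products, inverses and composition, so no such closure properties have to be
    established for [smooth_on]. *)
Definition C1 (U W : normedModType R) (g : U -> W) (x : U) : Prop :=
  (\forall y \near x, differentiable g y) /\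
  (forall v, {for x, continuous ('D_v g)}).

Context {U : normedModType R}.

Lemma C1_differentiable (W : normedModType R) (g : U -> W) x : C1 g x -> differentiable g x.
Proof. by move=> [/nbhs_singleton]. Qed.

Lemma C1_continuous (W : normedModType R) (g : U -> W) x : C1 g x -> {for x, continuous g}.
Proof. by move=> /C1_differentiable/differentiable_continuous. Qed.

Lemma derive_comp (V W : normedModType R) (g : U -> V) (f : V -> W) x v :
  differentiable g x -> differentiable f (g x) ->
  'D_v (fun y => f (g y)) x = 'D_('D_v g x) f (g x).
Proof.
move=> dg df; rewrite !deriveE//; last exact: differentiable_comp.
by rewrite (diff_comp dg df).
Qed.


Lemma near_eq_differentiable (W : normedModType R) (f g : U -> W) x :
  (\forall y \near x, f y = g y) -> differentiable f x -> differentiable g x.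
Proof.
move=> fg df.
have gdf : g \o shift x = cst (g x) + 'd f x +o_ 0 id.
  apply/eqaddoP => e e0; have /eqaddoP/(_ e e0) := diff_locally df.
  have fgs : \forall h \near 0, f (h + x) = g (h + x) by move: fg; rewrite (near_shift 0 x) subr0.
  apply: filter_app; near=> h.
  rewrite /= -!(nbhs_singleton fg).
  by rewrite -![(_ + _ : _ -> _) _]/(_ + _) -![(- _ : _ -> _) _]/(- _) /= (near fgs).
have e := diff_unique (diff_continuous df) gdf.
by apply/diff_locallyP; rewrite e; split => //; exact: diff_continuous.
Unshelve. all: by end_near. Qed.

Lemma C1_near (W : normedModType R) (f g : U -> W) x :
  (\forall y \near x, f y = g y) -> C1 f x -> C1 g x.
Proof.
move=> /near_join fg [df cf]; split.
  by near=> y; apply: (@near_eq_differentiable _ f); near: y.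
move=> v; suff : 'D_v g @ x --> 'D_v f x.
  by rewrite (near_eq_derive v (nbhs_singleton fg)).
apply: cvg_trans (cf v); apply: near_eq_cvg; near=> y.
by apply: near_eq_derive; near: y.
Unshelve. all: by end_near. Qed.

Lemma near_eq_continuous (T V : topologicalType) (f g : T -> V) x :
  (\forall y \near x, f y = g y) -> {for x, continuous f} -> {for x, continuous g}.
Proof.
move=> fg cf; suff : g @ x --> f x by rewrite (nbhs_singleton fg).
by apply: cvg_trans cf; apply: near_eq_cvg.
Qed.

Lemma continuous_at_entry (T : topologicalType) m n (G : T -> 'M[R]_(m, n)) x i j :
  {for x, continuous G} -> {for x, continuous (fun y => G y i j)}.
Proof.
move=> cG; apply: (@continuous_comp _ _ _ G (fun N : 'M[R]_(m, n) => N i j)) cG _.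
exact: coord_continuous.
Qed.

Lemma continuous_at_sum (T : topologicalType) (W : normedModType R) (I : Type) (r : seq I)
    (F : I -> T -> W) x :
  (forall i, {for x, continuous (F i)}) -> {for x, continuous (fun y => \sum_(i <- r) F i y)}.
Proof.
move=> cF; elim: r => [|i r IH].
  have -> : (fun y => \sum_(i <- [::]) F i y) = cst 0 by apply/funext => y; rewrite big_nil.
  exact: cst_continuous.
have -> : (fun y => \sum_(j <- i :: r) F j y) = (fun y => F i y + \sum_(j <- r) F j y).
  by apply/funext => y; rewrite big_cons.
exact: (cvgD (cF i) IH).
Qed.

Lemma C1_cst (W : normedModType R) (a : W) x : C1 (fun _ : U => a) x.
Proof.
split; first by near=> y; exact: differentiable_cst.
move=> v; have -> : 'D_v (fun _ : U => a) = cst 0 by apply/funext => y; exact: derive_cst.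
exact: cst_continuous.
Unshelve. all: by end_near. Qed.

Lemma C1D (W : normedModType R) (f g : U -> W) x :
  C1 f x -> C1 g x -> C1 (fun y => f y + g y) x.
Proof.
move=> [df cf] [dg cg]; split.
  near=> y; apply: differentiableD; [by near: y|by near: y].
move=> v; apply: (@near_eq_continuous _ _ (fun y => 'D_v f y + 'D_v g y)).
  near=> y; apply/esym/deriveD; apply: diff_derivable; [by near: y|by near: y].
exact: (cvgD (cf v) (cg v)).
Unshelve. all: by end_near. Qed.

Lemma C1M (f g : U -> R) x : C1 f x -> C1 g x -> C1 (fun y => f y * g y) x.
Proof.
move=> Cf Cg; move: (Cf) (Cg) => [df cf] [dg cg]; split.
  near=> y; apply: differentiableM; [by near: y|by near: y].
move=> v; apply: (@near_eq_continuous _ _ (fun y => f y * 'D_v g y + g y * 'D_v f y)).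
  near=> y; apply/esym/deriveM; apply: diff_derivable; [by near: y|by near: y].
apply: (cvgD (cvgM (C1_continuous Cf) (cg v)) (cvgM (C1_continuous Cg) (cf v))).
Unshelve. all: by end_near. Qed.

Lemma C1_sum (W : normedModType R) (I : Type) (r : seq I) (P : pred I) (F : I -> U -> W) x :
  (forall i, C1 (F i) x) -> C1 (fun y => \sum_(i <- r | P i) F i y) x.
Proof.
move=> CF; elim: r => [|i r IH].
  by under eq_fun do rewrite big_nil; exact: C1_cst.
under eq_fun do rewrite big_cons.
by case: (P i); [apply: C1D; [exact: CF|exact: IH]|exact: IH].
Qed.

Lemma C1_prod (I : Type) (r : seq I) (P : pred I) (F : I -> U -> R) x :
  (forall i, C1 (F i) x) -> C1 (fun y => \prod_(i <- r | P i) F i y) x.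
Proof.
move=> CF; elim: r => [|i r IH].
  by under eq_fun do rewrite big_nil; exact: C1_cst.
under eq_fun do rewrite big_cons.
by case: (P i); [apply: C1M; [exact: CF|exact: IH]|exact: IH].
Qed.

Lemma C1V (f : U -> R) x : f x != 0 -> C1 f x -> C1 (fun y => (f y)^-1) x.
Proof.
move=> fx0 Cf; move: (Cf) => [df cf].
have f0 : \forall y \near x, f y != 0.
  have := C1_continuous Cf; move/cvgrPdist_lt => /(_ `|f x|); rewrite normr_gt0 => /(_ fx0).
  by apply: filterS => y; apply: contraTneq => ->; rewrite subr0 ltxx.
split.
  near=> y; apply: differentiableV; [by near: y|by near: y].
move=> v; apply: (@near_eq_continuous _ _ (fun y => - (f y)^-1 ^+ 2 * 'D_v f y)).
  near=> y; rewrite exprVn; apply/esym/deriveV; first by near: y.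
  by apply: diff_derivable; near: y.
have cV : {for x, continuous (fun y => (f y)^-1)} by apply: cvgV => //; exact: C1_continuous.
exact: (cvgM (cvgN (cvgM cV cV)) (cf v)).
Unshelve. all: by end_near. Qed.

Lemma derive_entry m n (G : U -> 'M[R]_(m, n)) x v i j :
  differentiable G x -> 'D_v (fun y => G y i j) x = ('D_v G x) i j.
Proof. by move=> /diff_derivable dG; rewrite derive_mx// mxE. Qed.

Lemma differentiable_mx m n (G : U -> 'M[R]_(m, n)) x :
  (forall i j, differentiable (fun y => G y i j) x) -> differentiable G x.
Proof.
move=> dG.
have -> : G = \sum_(p < m) \sum_(q < n) (fun y => G y p q *: delta_mx p q).
  apply/funext => y; rewrite {1}(matrix_sum_delta (G y)) fct_sumE.
  by apply: eq_bigr => p _; rewrite fct_sumE.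
apply: differentiable_sum => p; apply: differentiable_sum => q.
exact: differentiableZl.
Qed.

Lemma differentiable_entry m n (G : U -> 'M[R]_(m, n)) x i j :
  differentiable G x -> differentiable (fun y => G y i j) x.
Proof. move=> dG.
by apply: (@differentiable_comp _ _ _ _ G (fun N : 'M[R]_(m, n) => N i j)) => //;
  exact: differentiable_coord. Qed.

Lemma C1_mx m n (G : U -> 'M[R]_(m, n)) x : (forall i j, C1 (fun y => G y i j) x) -> C1 G x.
Proof.
move=> CG.
have dG : \forall y \near x, differentiable G y.
  have : \forall y \near x, forall p : 'I_m * 'I_n, differentiable (fun y => G y p.1 p.2) y.
    by apply: filter_forall => p; have [] := CG p.1 p.2.
  by apply: filterS => y dy; apply: differentiable_mx => i j; exact: (dy (i, j)).
split=> // v.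
apply: (@near_eq_continuous _ _ (fun y => \matrix_(i, j) 'D_v (fun y => G y i j) y)).
  near=> y; rewrite derive_mx//; apply: diff_derivable; near: y; exact: dG.
apply/cvgrPdist_le => /= e e0; near=> y.
rewrite /Num.Def.normr/= mx_normrE (bigmax_le _ (ltW e0))//= => i _.
rewrite !mxE; move: i; near: y; apply: filter_forall => /= i.
have [_ /(_ v) c] := CG i.1 i.2.
exact: ((cvgrPdist_le _ _).1 c).
Unshelve. all: by end_near. Qed.

Lemma C1_entry m n (G : U -> 'M[R]_(m, n)) x i j : C1 G x -> C1 (fun y => G y i j) x.
Proof.
move=> [dG cG]; split.
  by apply: filterS dG => y; exact: differentiable_entry.
move=> v; apply: (@near_eq_continuous _ _ (fun y => ('D_v G y) i j)).
  by near=> y; rewrite derive_entry//; near: y.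
exact: continuous_at_entry.
Unshelve. all: by end_near. Qed.

Lemma derive_linear (W : normedModType R) (f : U -> W) x (c : R) u v :
  differentiable f x -> 'D_(c *: u + v) f x = c *: 'D_u f x + 'D_v f x.
Proof. by move=> df; rewrite !deriveE// linearP. Qed.

Lemma derive_row m (W : normedModType R) (f : 'rV[R]_m -> W) x u :
  differentiable f x -> 'D_u f x = \sum_(j < m) u 0 j *: 'D_(delta_mx 0 j) f x.
Proof.
move=> df; rewrite deriveE// [u in LHS]row_sum_delta linear_sum.
by apply: eq_bigr => j _; rewrite linearZ deriveE.
Qed.

Lemma C1_comp m (W : normedModType R) (G : U -> 'rV[R]_m) (f : 'rV[R]_m -> W) x :
  C1 G x -> C1 f (G x) -> C1 (fun y => f (G y)) x.
Proof.
move=> CG [df cf]; move: (CG) => [dG cG].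
have dfG : \forall y \near x, differentiable f (G y).
  exact: (C1_continuous CG df).
split.
  by near=> y; apply: differentiable_comp; [near: y|near: y; exact: dfG].
(* The direction ['D_v G y] moves with y, whereas [C1] controls only fixed directions; hence the
   expansion in the standard basis. *)
move=> v; apply: (@near_eq_continuous _ _
  (fun y => \sum_(j < m) ('D_v G y) 0 j *: 'D_(delta_mx 0 j) f (G y))).
  near=> y; have dGy : differentiable G y by near: y.
  have dfy : differentiable f (G y) by near: y; exact: dfG.
  by rewrite (derive_comp v dGy dfy) -derive_row.
have c j : {for x, continuous (fun y => ('D_v G y) 0 j *: 'D_(delta_mx 0 j) f (G y))}.
  have c2 : {for x, continuous (fun y => 'D_(delta_mx 0 j) f (G y))}.
    apply: (@continuous_comp _ _ _ G ('D_(delta_mx 0 j) f)); last exact: cf.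
    exact: C1_continuous.
  exact: (cvgZ (@continuous_at_entry _ _ _ _ _ 0 j (cG v)) c2).
exact: continuous_at_sum.
Unshelve. all: by end_near. Qed.

End C1.

Section SmoothOn.
Context {R : realType}.

Lemma smooth_on_derive k l (S : set 'rV[R]_k) (g : 'rV[R]_k -> 'rV[R]_l) v :
  smooth_on S g -> smooth_on S ('D_v g).
Proof. by move=> sg vs x Sx; exact: (sg (v :: vs) x Sx). Qed.

Lemma smooth_on_differentiable k l (S : set 'rV[R]_k) (g : 'rV[R]_k -> 'rV[R]_l) x :
  smooth_on S g -> S x -> differentiable g x.
Proof. by move=> sg Sx; exact: (sg [::] x Sx). Qed.

Lemma smooth_on_C1 k l (S : set 'rV[R]_k) (g : 'rV[R]_k -> 'rV[R]_l) x :
  nbhs x S -> smooth_on S g -> C1 g x.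
Proof.
move=> nS sg; split.
  by apply: filterS nS => y; exact: smooth_on_differentiable.
move=> v; apply: differentiable_continuous.
exact: (smooth_on_differentiable (smooth_on_derive v sg) (nbhs_singleton nS)).
Qed.

Lemma smooth_on_C1_derive k l (S : set 'rV[R]_k) (g : 'rV[R]_k -> 'rV[R]_l) x v :
  nbhs x S -> smooth_on S g -> C1 ('D_v g) x.
Proof. by move=> nS sg; exact: (smooth_on_C1 nS (smooth_on_derive v sg)). Qed.

End SmoothOn.

(** * Symmetry of second derivatives *)

Section Schwarz.
Context {R : realType} {U : normedModType R}.

Lemma line_is_derive (g : U -> R) (u y : U) (s : R) : differentiable g (s *: u + y) ->
  is_derive s (1 : R) (fun s => g (s *: u + y)) ('D_u g (s *: u + y)).
Proof.
have e (h : R) : (h *: (1 : R) + s) *: u + y = h *: u + (s *: u + y).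
  by rewrite scalerDl -addrA; congr (_ *: _ + _); exact: mulr1.
move=> dg; apply: DeriveDef.
  by apply: (@derivable_affine _ _ _ _ g (fun s : R => s *: u + y) _ _ _ e); exact: diff_derivable.
exact: (@derive_affine _ _ _ _ g (fun s : R => s *: u + y) _ _ _ e).
Qed.

Lemma mean_value (f df : R -> R) (h : R) : 0 <= h ->
  (forall s, 0 <= s <= h -> is_derive s (1 : R) f (df s)) ->
  exists2 s, 0 <= s <= h & f h - f 0 = df s * h.
Proof.
move=> h0 dfE; have [|s|s] := @MVT_segment R f df 0 h h0.
- by move=> s; rewrite in_itv/= => /andP[s0 sh]; apply: dfE; rewrite !ltW.
- apply: derivable_within_continuous => {}s; rewrite in_itv/= => sI.
  by have [] := dfE s sI.
- by rewrite in_itv/= subr0 => sI ->; exists s.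
Qed.

(** The mean value theorem, applied along u and then to ['D_u g] along v, turns the second
    difference into h^2 times a mixed derivative at a point of the small parallelogram, close to its
    value at x by continuity. *)
Lemma second_difference (g : U -> R) (x u v : U) (e : R) : 0 < e ->
  C1 g x -> C1 ('D_u g) x ->
  \forall h \near 0^'+,
    `|g (h *: u + (h *: v + x)) - g (h *: u + x) - (g (h *: v + x) - g x)
      - 'D_v ('D_u g) x * h * h| <= e * h * h.
Proof.
move=> e0 [dg _] [dgu /(_ v) cguv].
have /nbhs_ballP[r /= r0 xr] : \forall y \near x, [/\ differentiable g y,
    differentiable ('D_u g) y & `|'D_v ('D_u g) x - 'D_v ('D_u g) y| <= e].
  near=> y; split; [by near: y|by near: y|near: y].
  exact: ((cvgrPdist_le _ _).1 cguv).
(* A parallelogram with sides h u and h v based at x stays within distance h M of x; the summand 1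
   keeps M positive when u = v = 0. *)
pose M := `|u| + `|v| + 1.
have M0 : 0 < M by rewrite ltr_wpDl// addr_ge0.
near=> h.
have h0 : 0 < h by near: h; exact: nbhs_right_gt.
have hr : h * M < r.
  by rewrite -ltr_pdivlMr//; near: h; apply: nbhs_right_lt; rewrite divr_gt0.
have inN s t : 0 <= s <= h -> 0 <= t <= h -> ball x r (s *: u + (t *: v + x)).
  move=> /andP[s0 sh] /andP[t0 th]; rewrite -ball_normE/= distrC addrA addrK.
  rewrite (le_lt_trans (ler_normD _ _))// !normrZ !ger0_norm// (le_lt_trans _ hr)//.
  rewrite /M !mulrDr mulr1 -addrA lerD ?ler_wpM2r//.
  by apply: ler_wpDr; [exact: ltW|exact: ler_wpM2r].
have hh : 0 <= h <= h by rewrite lexx ltW.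
have h00 : (0 : R) <= 0 <= h by rewrite lexx ltW.
pose phi s := g (s *: u + (h *: v + x)) - g (s *: u + x).
have dphi s : 0 <= s <= h -> is_derive s (1 : R) phi
    ('D_u g (s *: u + (h *: v + x)) - 'D_u g (s *: u + x)).
  move=> sh; apply: is_deriveB; apply: line_is_derive.
    by have [] := xr _ (inN _ _ sh hh).
  by have [] := xr _ (inN _ 0 sh h00); rewrite scale0r add0r.
have [s sh] := mean_value (ltW h0) dphi; rewrite /phi !scale0r !add0r => ->.
have dpsi t : 0 <= t <= h -> is_derive t (1 : R) (fun t => 'D_u g (t *: v + (s *: u + x)))
    ('D_v ('D_u g) (t *: v + (s *: u + x))).
  by move=> th; apply: line_is_derive; rewrite addrCA; have [] := xr _ (inN _ _ sh th).
have [t th] := mean_value (ltW h0) dpsi; rewrite scale0r add0r addrCA => ->.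
rewrite -!mulrBl normrM normrM !(gtr0_norm h0) !ler_pM2r// distrC addrCA.
by have [] := xr _ (inN _ _ sh th).
Unshelve. all: by end_near. Qed.

(** The second difference is symmetric in u and v, so for one common small h it is within e/2 h^2 of
    both candidates p h^2 and q h^2; dividing by h^2 gives a distance of at most e. *)
Lemma derive_derive_comm (g : U -> R) (x u v : U) :
  C1 g x -> C1 ('D_u g) x -> C1 ('D_v g) x ->
  'D_v ('D_u g) x = 'D_u ('D_v g) x.
Proof.
move=> Cg Cu Cv; apply/eqP; rewrite -subr_eq0 -normr_le0; apply/ler_addgt0Pl => e e0.
have e20 : 0 < e / 2 by rewrite divr_gt0.
have F1 := second_difference v e20 Cg Cu; have F2 := second_difference u e20 Cg Cv.
rewrite addr0.
have [h [[h0 H1] H2]] : exists h : R, (0 < h /\ _) /\ _ :=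
  filter_ex (@filterI _ _ _ _ _ (@filterI _ _ _ _ _ (nbhs_right_gt (0 : R)) F1) F2).
have E : h *: v + (h *: u + x) = h *: u + (h *: v + x) by rewrite addrCA.
rewrite E in H2; move: H1 H2.
move: (g (h *: u + (h *: v + x))) (g (h *: u + x)) (g (h *: v + x)) (g x).
move: ('D_v ('D_u g) x) ('D_u ('D_v g) x) => p q a b c d H1 H2.
rewrite -(ler_pM2r h0) -(ler_pM2r h0).
have -> : `|p - q| * h * h = `|(a - c - (b - d) - q * h * h) - (a - b - (c - d) - p * h * h)|.
  rewrite -[h in _ * h * _](gtr0_norm h0) -[h in _ * h](gtr0_norm h0) -!normrM.
  by congr `|_|; ring.
rewrite (le_trans (ler_normB _ _))// (le_trans (lerD H2 H1))//.
by rewrite {3}(splitr e) !mulrDl.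
Qed.

End Schwarz.

(** * Leibniz rule for forms evaluated on moving vectors *)

Section Leibniz.
Context {R : realType} {U : normedModType R} {m : nat}.

Lemma deriv_sum (W : normedModType R) (I : Type) (r : seq I) (F : I -> U -> W) x v :
  (forall i, C1 (F i) x) ->
  'D_v (fun y => \sum_(i <- r) F i y) x = \sum_(i <- r) 'D_v (F i) x.
Proof.
move=> CF; elim: r => [|i r IH].
  have -> : (fun y => \sum_(i <- [::]) F i y) = cst 0 by apply/funext => y; rewrite big_nil.
  by rewrite big_nil derive_cst.
have -> : (fun y => \sum_(j <- i :: r) F j y) = (F i + (fun y => \sum_(j <- r) F j y)).
  by apply/funext => y; rewrite big_cons.
rewrite big_cons -IH; apply: deriveD; apply/diff_derivable/C1_differentiable => //.
exact: C1_sum.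
Qed.

Lemma derive_mul (f g : U -> R) x v : C1 f x -> C1 g x ->
  'D_v (fun y => f y * g y) x = f x * 'D_v g x + g x * 'D_v f x.
Proof.
move=> /C1_differentiable df /C1_differentiable dg.
by apply: deriveM; exact: diff_derivable.
Qed.

Lemma derive_sum_mul (I : Type) (r : seq I) (f g : I -> U -> R) x v :
  (forall i, C1 (f i) x) -> (forall i, C1 (g i) x) ->
  'D_v (fun y => \sum_(i <- r) f i y * g i y) x =
  \sum_(i <- r) (f i x * 'D_v (g i) x + g i x * 'D_v (f i) x).
Proof.
move=> Cf Cg; rewrite deriv_sum; last by move=> i; exact: C1M.
by apply: eq_bigr => i _; rewrite derive_mul.
Qed.

Lemma multilinear_row k (a : ('I_k.+1 -> 'rV[R]_m) -> R) u w : multilinear a ->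
  a (fcons u w) = \sum_(j < m) u 0 j * a (fcons (delta_mx 0 j) w).
Proof.
move=> ma; rewrite -(update_fcons0 0) [u in LHS]row_sum_delta multilinear_sum//.
by apply: eq_bigr => j _; rewrite update_fcons0.
Qed.

(** Induction on the degree: the first argument is expanded in the standard basis, which leaves a
    finite sum of products of a coordinate with a form of lower degree. *)
Lemma C1_leibniz k (theta : U -> ('I_k -> 'rV[R]_m) -> R) (u : 'I_k -> U -> 'rV[R]_m) t :
  (\forall s \near t, multilinear (theta s)) ->
  (forall w, C1 (fun s => theta s w) t) -> (forall i, C1 (u i) t) ->
  C1 (fun s => theta s (fun i => u i s)) t /\
  forall v, 'D_v (fun s => theta s (fun i => u i s)) t =
    'D_v (fun s => theta s (fun i => u i t)) t +
    \sum_(i < k) theta t (update (fun i => u i t) i ('D_v (u i) t)).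
Proof.
elim: k theta u => [|k IH] theta u mth Cth Cu.
  have -> : (fun s => theta s (fun i => u i s)) = (fun s => theta s (fun i => u i t)).
    by apply/funext => s; congr theta; apply/funext => -[].
  by split=> [|v]; rewrite ?big_ord0 ?addr0.
have mt := nbhs_singleton mth.
pose u' i := u (lift ord0 i).
have uE s : (fun i => u i s) = fcons (u ord0 s) (fun i => u' i s).
  exact: (esym (fcons_eta (fun i => u i s))).
pose th j s w := theta s (fcons (delta_mx 0 j) w).
have mth' j : \forall s \near t, multilinear (th j s).
  by apply: filterS mth => s; exact: multilinear_fcons.
have {}IH j := IH (th j) u' (mth' j) (fun w => Cth _) (fun i => Cu _).
have Cu0 j : C1 (fun s => u ord0 s 0 j) t by apply: C1_entry; exact: Cu.
have Cth0 j : C1 (fun s => th j s (fun i => u' i s)) t by case: (IH j).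
have E : \forall s \near t, \sum_(j < m) u ord0 s 0 j * th j s (fun i => u' i s) =
    theta s (fun i => u i s).
  by apply: filterS mth => s ms; rewrite uE (multilinear_row (u ord0 _) _ ms).
split; first by apply: C1_near E _; apply: C1_sum => j; exact: C1M.
move=> v; rewrite -(near_eq_derive v E).
rewrite (derive_sum_mul _ _ Cu0 Cth0).
under eq_bigr do rewrite (IH _).2 mulrDr -addrA.
rewrite big_split/=; congr (_ + _).
  have E' : \forall s \near t, \sum_(j < m) u ord0 t 0 j * th j s (fun i => u' i t) =
      theta s (fun i => u i t).
    by apply: filterS mth => s ms; rewrite uE (multilinear_row (u ord0 _) _ ms).
  rewrite -(near_eq_derive v E') derive_sum_mul; last by move=> j; exact: Cth.
    apply: eq_bigr => j _; rewrite derive_cst mulr0 addr0.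
    by [].
  by move=> j; exact: C1_cst.
rewrite big_split/= big_ord_recl addrC; congr (_ + _).
  rewrite uE update_fcons0 (multilinear_row _ _ mt).
  apply: eq_bigr => j _; rewrite mulrC derive_entry//.
  exact/C1_differentiable/Cu.
under eq_bigr do rewrite mulr_sumr.
rewrite exchange_big/=; apply: eq_bigr => i _.
by rewrite uE update_fcons_lift (multilinear_row _ _ mt).
Qed.

End Leibniz.

Section MatrixC1.
Context {R : realType} {U : normedModType R}.

Lemma C1_mulmx m n p (A : U -> 'M[R]_(m, n)) (B : U -> 'M[R]_(n, p)) x :
  C1 A x -> C1 B x -> C1 (fun y => A y *m B y) x.
Proof.
move=> CA CB; apply: C1_mx => i j; under eq_fun do rewrite mxE.
by apply: C1_sum => k; apply: C1M; exact: C1_entry.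
Qed.

Lemma C1_det n (A : U -> 'M[R]_n) x : C1 A x -> C1 (fun y => \det (A y)) x.
Proof.
move=> CA; apply: C1_sum => s; apply: C1M; first exact: C1_cst.
by apply: C1_prod => i; exact: C1_entry.
Qed.

Lemma C1_adjugate n (A : U -> 'M[R]_n) x : C1 A x -> C1 (fun y => \adj (A y)) x.
Proof.
move=> CA; apply: C1_mx => i j; under eq_fun do rewrite mxE.
apply: C1M; first exact: C1_cst.
apply: C1_det; apply: C1_mx => k l; under eq_fun do rewrite !mxE.
exact: C1_entry.
Qed.

(** A left inverse A of [M x] is chosen row by row. Near x the matrix [A *m M y] stays invertible,
    and its inverse times A is a left inverse of [M y]; Cramer's formula makes the C^1 dependence
    visible. *)
Lemma C1_left_inverse m l (M : U -> 'M[R]_(m, l)) x : C1 M x ->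
  (forall v : 'rV_l, exists u, u *m M x = v) ->
  exists L : U -> 'M[R]_(l, m), C1 L x /\ \forall y \near x, L y *m M y = 1%:M.
Proof.
move=> CM surjM; pose a i := sval (cid (surjM (delta_mx 0 i))).
have aM i : a i *m M x = delta_mx 0 i by exact: (svalP (cid (surjM (delta_mx 0 i)))).
pose A := \matrix_i a i.
have AM : A *m M x = 1%:M.
  by apply/row_matrixP => i; rewrite row_mul rowK aM rowE mulmx1.
have CAM : C1 (fun y => A *m M y) x by apply: C1_mulmx => //; exact: C1_cst.
have Cd := C1_det CAM.
have d0 : \det (A *m M x) != 0 by rewrite AM det1 oner_neq0.
exists (fun y => (\det (A *m M y))^-1 *: (\adj (A *m M y) *m A)); split.
  apply: C1_mx => i j; under eq_fun do rewrite mxE.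
  apply: C1M; first exact: C1V.
  by apply: C1_entry; apply: C1_mulmx; [exact: C1_adjugate|exact: C1_cst].
have := C1_continuous Cd; move/cvgrPdist_lt => /(_ `|\det (A *m M x)|).
rewrite normr_gt0 => /(_ d0); apply: filterS => y.
have [->|dy _] := eqVneq (\det (A *m M y)) 0; first by rewrite subr0 ltxx.
by rewrite -scalemxAl -mulmxA mul_adj_mx scale_scalar_mx mulVf.
Qed.

Lemma derive_derive_comm_mx m n (G : U -> 'M[R]_(m, n)) (x u v : U) :
  C1 G x -> C1 ('D_u G) x -> C1 ('D_v G) x ->
  'D_v ('D_u G) x = 'D_u ('D_v G) x.
Proof.
move=> CG Cu Cv; apply/matrixP => i j.
apply: etrans (esym (derive_entry v i j (C1_differentiable Cu))) _.
apply: etrans (derive_entry u i j (C1_differentiable Cv)).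
have E w : \forall y \near x, ('D_w G y) i j = 'D_w (fun z => G z i j) y.
  by case: CG => dG _; apply: filterS dG => y dGy; rewrite (derive_entry w i j dGy).
rewrite (near_eq_derive _ (E u)) (near_eq_derive _ (E v)).
apply: derive_derive_comm; first exact: C1_entry.
  by apply: C1_near (E u) _; exact: C1_entry.
by apply: C1_near (E v) _; exact: C1_entry.
Qed.

End MatrixC1.

(** * Contraction of a closed form along a submersion *)

Section ClosedContraction.
Context {R : realType} {m l k n : nat}.
Notation V := 'rV[R]_m.
Implicit Types (F : V -> 'rV[R]_l) (theta : V -> ('I_n.+1 -> V) -> R).

Definition jac F (y : V) : 'M[R]_(m, l) := \matrix_(i, j) ('D_(delta_mx 0 i) F y) 0 j.

Lemma mul_jac F y u : differentiable F y -> u *m jac F y = 'D_u F y.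
Proof.
move=> dF; rewrite (derive_row u dF); apply/rowP => j; rewrite mxE summxE.
by apply: eq_bigr => i _; rewrite !mxE.
Qed.

Lemma C1_jac F y : (forall u, C1 ('D_u F) y) -> C1 (jac F) y.
Proof.
move=> CF; apply: C1_mx => i j; under eq_fun do rewrite mxE.
exact: C1_entry.
Qed.

(** This differentiates the constant function z |-> ['D_(Z z) F z] in direction u. It serves to
    compute the image under the differential of F of the bracket of two projectable fields. The
    covector is treated as a 1-form so that [C1_leibniz] applies. *)
Lemma derive_along_field F (Z : V -> V) y u c :
  C1 F y -> (forall w, C1 ('D_w F) y) -> C1 Z y ->
  (\forall z \near y, 'D_(Z z) F z = c) ->
  'D_('D_u Z y) F y = - 'D_u ('D_(Z y) F) y.
Proof.
move=> CF C2F CZ Zc; apply/rowP => j; rewrite [in RHS]mxE.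
have dF := CF.1.
pose theta (z : V) (w : 'I_1 -> V) := ('D_(w ord0) F z) 0 j.
have mth : \forall z \near y, multilinear (theta z).
  apply: filterS dF => z dFz w i a p q; rewrite /theta ord1 !update_same.
  by rewrite (derive_linear a p q dFz) !mxE.
have Cth w : C1 (fun z => theta z w) y by apply: C1_entry; exact: C2F.
have [_ /(_ u)] := @C1_leibniz _ _ _ _ theta (fun=> Z) y mth Cth (fun=> CZ).
rewrite big_ord_recl big_ord0 addr0 /theta update_same.
have E : \forall z \near y, (c 0 j : R) = ('D_(Z z) F z) 0 j.
  by apply: filterS Zc => z ->.
move=> /(etrans (near_eq_derive u E)); rewrite derive_cst.
rewrite (derive_entry u 0 j (C1_differentiable (C2F (Z y)))) => /eqP.
by rewrite eq_sym addrC addr_eq0 => /eqP.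
Qed.

Lemma local_section F (y : V) : C1 F y -> (forall u, C1 ('D_u F) y) ->
  (forall w, exists u, 'D_u F y = w) ->
  exists L : V -> 'M[R]_(l, m), C1 L y /\ \forall z \near y, forall w, 'D_(w *m L z) F z = w.
Proof.
move=> CF C2F surjF; have dF := CF.1.
have [|w|L [CL LJ]] := @C1_left_inverse _ _ _ _ (jac F) y; first exact: C1_jac.
  have [u uw] := surjF w; exists u.
  by rewrite mul_jac//; exact: nbhs_singleton dF.
exists L; split=> //; apply: filterS2 dF LJ => z dFz LJz w.
by rewrite -(mul_jac _ dFz) -mulmxA LJz mulmx1.
Qed.

(** The hypothesis on [gamma] quantifies over all lifts u of v: the pointwise choice made by
    [contract] is one of them, and the C^1 lift used in the proof is another. Vanishing of theta is
    assumed near y and not only along G, because theta is going to be differentiated transversally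
    to the fibre. *)
Lemma closed_contraction theta F (y : V) (v : 'rV[R]_l) (G : 'rV[R]_k -> V) t
    (gamma : 'I_n.+1 -> 'rV[R]_k -> R) (e : 'I_n.+1 -> 'rV[R]_k) :
  (\forall z \near y, multilinear (theta z)) ->
  (\forall z \near y, alternating (theta z)) ->
  (forall w, C1 (fun z => theta z w) y) ->
  (forall w : 'I_n.+2 -> V, \sum_(i < n.+2) (-1) ^+ i *
    'D_(w i) (fun z => theta z (fun j => w (lift i j))) y = 0) ->
  C1 F y -> (forall u, C1 ('D_u F) y) ->
  (forall w, exists u, 'D_u F y = w) ->
  (\forall z \near y, forall w, (forall i, 'D_(w i) F z = 0) -> theta z w = 0) ->
  G t = y -> C1 G t -> (forall w, C1 ('D_w G) t) ->
  (forall w, 'D_('D_w G t) F y = 0) ->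
  (\forall s \near t, forall i u, 'D_u F (G s) = v ->
    gamma i s = theta (G s) (fcons u (fun j => 'D_(e (lift i j)) G s))) ->
  (forall i, C1 (gamma i) t) /\ \sum_(i < n.+1) (-1) ^+ i * 'D_(e i) (gamma i) t = 0.
Proof.
move=> mth ath Cth clo CF C2F surjF van Gt CG C2G vG gammaE.
have dF := CF.1.
have [L [CL LF]] := local_section CF C2F surjF.
(* Z lifts v, and P w extends a vertical vector w to a vertical field. *)
pose Z z := v *m L z.
have CZ : C1 Z y by apply: C1_mulmx CL; exact: C1_cst.
have ZF : \forall z \near y, 'D_(Z z) F z = v by apply: filterS LF => z LFz; exact: LFz.
pose P u z := u - 'D_u F z *m L z.
have CP u : C1 (P u) y.
  apply: C1D; first exact: C1_cst.
  apply: C1_near (C1_mulmx (C1_mulmx (C1_cst (-1)%:M y) (C2F u)) CL).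
  by near=> z; rewrite mul_scalar_mx scaleN1r mulNmx.
have PF u : \forall z \near y, 'D_(P u z) F z = 0.
  apply: filterS2 dF LF => z dFz LFz.
  by rewrite /P addrC -scaleN1r (derive_linear _ _ _ dFz) LFz scaleN1r addNr.
have P0 u : 'D_u F y = 0 -> P u y = u by move=> uF; rewrite /P uF mul0mx subr0.
pose u i := 'D_(e i) G t.
have Pu i : P (u i) y = u i by apply: P0; exact: vG.
have mthy := nbhs_singleton mth; have athy := nbhs_singleton ath.
(* The bracket of P (u i) and Z is vertical. *)
have bracket i : 'D_('D_(u i) Z y - 'D_(Z y) (P (u i)) y) F y = 0.
  rewrite addrC -scaleN1r (derive_linear _ _ _ (C1_differentiable CF)) scaleN1r.
  rewrite (derive_along_field _ CF C2F CZ ZF) (derive_along_field _ CF C2F (CP _) (PF _)).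
  by rewrite Pu opprK (derive_derive_comm_mx CF (C2F (u i)) (C2F (Z y))) addrN.
pose U i j := fcons (fun s => Z (G s)) (fun j s => 'D_(e (lift i j)) G s) j.
have UE i s : (fun j => U i j s) = fcons (Z (G s)) (fun j => 'D_(e (lift i j)) G s).
  apply/funext => j; rewrite /U; case: (unliftP ord0 j) => [j'|] ->.
    by rewrite !fcons_lift.
  by rewrite !fcons0.
have CZG : C1 (fun s => Z (G s)) t by apply: C1_comp CG _; rewrite Gt.
have CU i j : C1 (U i j) t.
  rewrite /U; case: (unliftP ord0 j) => [j'|] ->.
    by rewrite fcons_lift; exact: C2G.
  by rewrite fcons0.
have cG := C1_continuous CG.
have nearG (Q : set V) : nbhs y Q -> \forall s \near t, Q (G s) by rewrite -Gt => /cG.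
have mG : \forall s \near t, multilinear (theta (G s)) by exact: nearG mth.
have CthG w : C1 (fun s => theta (G s) w) t.
  by apply: (C1_comp (f := fun z => theta z w) CG); rewrite Gt.
have {gammaE}gammaE i : \forall s \near t, theta (G s) (fun j => U i j s) = gamma i s.
  have ZG : \forall s \near t, 'D_(Z (G s)) F (G s) = v by exact: nearG ZF.
  by apply: filterS2 gammaE ZG => s gE ZGs; rewrite UE (gE i _ ZGs).
have leib i := C1_leibniz mG CthG (CU i).
split=> [i|]; first by apply: C1_near (gammaE i) _; exact: (leib i).1.
(* Three contributions to the derivative of theta (Z, velocities of G): from the point of
   evaluation, from Z, and from the velocities. The last consists of second derivatives of G and
   cancels in the alternating sum. *)
have dgamma i : 'D_(e i) (gamma i) t =
    'D_(u i) (fun z => theta z (fcons (Z y) (fun j => u (lift i j)))) y +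
    ((-1) ^+ i * theta y (update u i ('D_(u i) Z y)) +
     \sum_(j < n) theta y (fcons (Z y)
       (update (fun j => u (lift i j)) j ('D_(e i) ('D_(e (lift i j)) G) t)))).
  rewrite -(near_eq_derive (e i) (gammaE i)) (leib i).2 UE Gt; congr (_ + _).
    rewrite (derive_comp (f := fun z => theta z (fcons (Z y) (fun j => u (lift i j))))
      _ (C1_differentiable CG)) ?Gt//.
    exact: C1_differentiable.
  rewrite big_ord_recl update_fcons0 -alternating_insert//; congr (_ + _).
    rewrite {1}/U fcons0 (derive_comp (f := Z) _ (C1_differentiable CG)) ?Gt//.
    exact: C1_differentiable.
  apply: eq_bigr => j _; rewrite update_fcons_lift.
  by rewrite {1}/U fcons_lift.
under eq_bigr do rewrite dgamma !mulrDr signrMK.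
rewrite !big_split/= (sum_omit_symmetric u (b := fun w => theta y (fcons (Z y) w))
  (S := fun i j => 'D_(e i) ('D_(e j) G) t)); last first.
- by move=> i j; exact: (derive_derive_comm_mx CG (C2G (e j)) (C2G (e i))).
- exact: alternating_fcons.
- exact: multilinear_fcons.
(* Closedness on (Z, u_0, .., u_n) replaces the alternating sum of derivatives along the u_i by the
   single derivative of theta (u_0, .., u_n) along Z. *)
have := clo (fcons (Z y) u); rewrite big_ord_recl expr0 mul1r fcons0.
under [X in _ + X]eq_bigr => i _.
  rewrite fcons_lift lift0 exprS mulN1r mulNr.
  have -> : (fun j => fcons (Z y) u (lift (lift ord0 i) j)) =
      fcons (Z y) (fun j => u (lift i j)).
    apply/funext => j; case: (unliftP ord0 j) => [j'|] ->.
      by rewrite lift_liftE !fcons_lift.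
    have -> : lift (lift ord0 i) ord0 = ord0 :> 'I_n.+2 by apply: val_inj.
    by rewrite !fcons0.
  over.
have -> : (fun j => fcons (Z y) u (lift ord0 j)) = u.
  by apply/funext => j; rewrite fcons_lift.
rewrite sumrN => /eqP; rewrite subr_eq0 => /eqP <-.
(* Since theta vanishes on the vertical fields P (u_i) near y, that derivative equals minus the sum
   of the terms containing ['D_(Z y) (P (u i)) y]. Together with the terms from Z they form
   brackets, which are vertical. *)
have [_ /(_ (Z y))] := C1_leibniz mth Cth (fun i => CP (u i)).
have -> : (fun i => P (u i) y) = u by apply/funext => i; rewrite Pu.
have PP0 : \forall z \near y, (0 : R) = theta z (fun i => P (u i) z).
  have PFa : \forall z \near y, forall i, 'D_(P (u i) z) F z = 0.
    by near=> z => i; move: i; near: z; apply: filter_forall => i; exact: PF.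
  by apply: filterS2 van PFa => z vz Pz; rewrite vz.
rewrite -(near_eq_derive (Z y) PP0) derive_cst addr0 => /esym/eqP.
rewrite addr_eq0 => /eqP ->; rewrite addrC -sumrB big1// => i _.
rewrite -multilinearB//; apply: (nbhs_singleton van) => j.
rewrite /update; case: eqP => // _; exact: vG.
Unshelve. all: by end_near. Qed.

End ClosedContraction.

(** * Manifolds *)

Section Charts.
Context {R : realType} {m : nat} {M : manifold R m}.

Lemma near_dom (T : topologicalType) (g : T -> M) (p : M) t :
  {for t, continuous g} -> dom p (g t) -> \forall s \near t, dom p (g s).
Proof. by move=> cg pg; apply: cg; apply: open_nbhs_nbhs; split => //; exact: dom_open. Qed.

Lemma near_cod (p : M) y : cod p y -> \forall z \near y, cod p z.
Proof. by move=> py; apply: open_nbhs_nbhs; split => //; exact: cod_open. Qed.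

Lemma transition_differentiable (p q : M) y : cod p y -> dom q (psi p y) ->
  differentiable (fun z => phi q (psi p z)) y.
Proof. by move=> py qy; exact: (smooth_on_differentiable (@transition_smooth _ _ _ p q)). Qed.

(** A tangent vector at x has its coordinates in the chart centred at x, so along a moving point the
    reference chart changes with the point. This rule carries such derivatives into one fixed
    chart. *)
Lemma chart_change (U : normedModType R) (g : U -> M) (p q : M) t :
  {for t, continuous g} -> dom p (g t) -> dom q (g t) ->
  differentiable (fun s => phi p (g s)) t ->
  differentiable (fun s => phi q (g s)) t /\
  forall w, 'D_w (fun s => phi q (g s)) t =
    'D_('D_w (fun s => phi p (g s)) t) (fun z => phi q (psi p z)) (phi p (g t)).
Proof.
move=> cg pg qg dg.
have E : \forall s \near t, phi q (psi p (phi p (g s))) = phi q (g s).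
  by apply: filterS (near_dom cg pg) => s ps; rewrite phiK.
have dT : differentiable (fun z => phi q (psi p z)) (phi p (g t)).
  by apply: transition_differentiable; [exact: phi_cod|rewrite phiK].
split.
  apply: near_eq_differentiable E _.
  exact: (@differentiable_comp _ _ _ _ (fun s => phi p (g s)) (fun z => phi q (psi p z))).
by move=> w; rewrite -(near_eq_derive w E) (derive_comp w dg dT).
Qed.

Lemma transition_inverse (p q : M) y u : cod p y -> dom q (psi p y) ->
  'D_('D_u (fun z => phi q (psi p z)) y) (fun z => phi p (psi q z)) (phi q (psi p y)) = u.
Proof.
move=> py qy; have E : \forall z \near y, phi p (psi p z) = z.
  by apply: filterS (near_cod py) => z pz; rewrite psiK.
have [_ <-] := chart_change (psi_continuous py) qy (psi_dom py) (transition_differentiable py qy).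
by rewrite (near_eq_derive u E) derive_id.
Qed.

Lemma transition_surjective (p q : M) y v : cod p y -> dom q (psi p y) ->
  exists u, 'D_u (fun z => phi q (psi p z)) y = v.
Proof.
move=> py qy.
exists ('D_v (fun z => phi p (psi q z)) (phi q (psi p y))).
have := @transition_inverse q p (phi q (psi p y)) v (phi_cod qy).
by rewrite phiK// psiK//; apply; exact: psi_dom.
Qed.

Lemma tangent_psi (p : M) y u :
  tangent_euclid (psi p) y u = 'D_u (fun z => phi (psi p y) (psi p z)) y.
Proof. by []. Qed.

Lemma tangent_psi_linear (p : M) y (c : R) u v : cod p y ->
  tangent_euclid (psi p) y (c *: u + v) =
  c *: tangent_euclid (psi p) y u + tangent_euclid (psi p) y v.
Proof.
move=> py; rewrite !tangent_psi derive_linear//.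
by apply: transition_differentiable => //; exact: dom_center.
Qed.

Lemma tangent_psi_surjective (p : M) y v : cod p y ->
  exists u, tangent_euclid (psi p) y u = v.
Proof. by move=> py; apply: transition_surjective => //; exact: dom_center. Qed.

Lemma tangent_euclid_chart k (g : 'rV[R]_k -> M) (p : M) t w :
  {for t, continuous g} -> dom p (g t) -> differentiable (fun s => phi p (g s)) t ->
  tangent_euclid g t w = tangent_euclid (psi p) (phi p (g t)) ('D_w (fun s => phi p (g s)) t).
Proof.
move=> cg pg dg; rewrite tangent_psi phiK// /tangent_euclid.
by have [_ ->] := chart_change cg pg (dom_center (g t)) dg.
Qed.

Lemma smooth_euclid_differentiable k (g : 'rV[R]_k -> M) (p : M) t :
  smooth_euclid g -> dom p (g t) -> differentiable (fun s => phi p (g s)) t.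
Proof. by move=> [_ sg]; exact: smooth_on_differentiable (sg p). Qed.

End Charts.

(** * Tangent maps read in fixed charts *)

Section TangentMap.
Context {R : realType} {m l : nat} {M : manifold R m} {N : manifold R l} (f : M -> N).
Hypothesis fsm : smooth_map setT f.

Let fcont x : {for x, continuous f}.
Proof. by case: fsm => cf _; exact: cf. Qed.

Lemma continuous_map_psi (p : M) y : cod p y -> {for y, continuous (fun z => f (psi p z))}.
Proof. by move=> py; apply: (continuous_comp (psi_continuous py)); exact: fcont. Qed.

Definition in_charts (p : M) (b : N) (y : 'rV[R]_m) : 'rV[R]_l := phi b (f (psi p y)).

Lemma smooth_in_charts (p : M) (b : N) y : cod p y -> dom b (f (psi p y)) ->
  exists S, nbhs y S /\ smooth_on S (in_charts p b).
Proof.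
move=> py bfy; case: fsm => _ /(_ p b) sf; eexists; split; last exact: sf.
apply: filterS2 (near_cod py) (near_dom (continuous_map_psi py) bfy) => z pz bz.
by split.
Qed.

Lemma differentiable_in_charts (p : M) (b : N) y : cod p y -> dom b (f (psi p y)) ->
  differentiable (in_charts p b) y.
Proof.
move=> py bfy; have [S [yS sS]] := smooth_in_charts py bfy.
exact: (smooth_on_differentiable sS (nbhs_singleton yS)).
Qed.

Lemma tangent_map_linear x (c : R) u v :
  tangent_map f x (c *: u + v) = c *: tangent_map f x u + tangent_map f x v.
Proof.
apply: derive_linear.
have := @differentiable_in_charts x (f x) (phi x x); rewrite phiK; last exact: dom_center.
by apply; [exact/phi_cod/dom_center|exact: dom_center].
Qed.

(** The source charts cancel, but a transition from the chart at b to the one at f (psi p y)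
    remains. It is linear on tangent vectors, so vertical vectors over nearby points can still be
    recognised in the fixed charts. *)
Lemma tangent_map_chart (p : M) (b : N) y u : cod p y -> dom b (f (psi p y)) ->
  tangent_map f (psi p y) (tangent_euclid (psi p) y u) =
  'D_('D_u (in_charts p b) y) (fun z => phi (f (psi p y)) (psi b z)) (phi b (f (psi p y))).
Proof.
move=> py bfy; set x := psi p y.
have [_ <-] := chart_change (continuous_map_psi py) bfy (dom_center (f (psi p y)))
  (differentiable_in_charts py bfy).
have px := dom_center x.
have E : \forall z \near y, phi (f x) (f (psi x (phi x (psi p z)))) = phi (f x) (f (psi p z)).
  by apply: filterS (near_dom (psi_continuous py) px) => z xz; rewrite phiK.
rewrite -(near_eq_derive u E).
rewrite (derive_comp (f := in_charts x (f x)) (g := fun z => phi x (psi p z))) //.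
  exact: transition_differentiable.
by apply: differentiable_in_charts; [exact: phi_cod|rewrite phiK//; exact: dom_center].
Qed.

Lemma tangent_map_comp k (g : 'rV[R]_k -> M) t w : smooth_euclid g ->
  tangent_map f (g t) (tangent_euclid g t w) = 'D_w (fun s => phi (f (g t)) (f (g s))) t.
Proof.
move=> sg; have cg : {for t, continuous g} by case: sg => cg _; exact: cg.
have px := dom_center (g t).
have E : \forall s \near t,
    phi (f (g t)) (f (psi (g t) (phi (g t) (g s)))) = phi (f (g t)) (f (g s)).
  by apply: filterS (near_dom cg px) => s xs; rewrite phiK.
rewrite -(near_eq_derive w E).
rewrite (derive_comp (f := in_charts (g t) (f (g t))) (g := fun s => phi (g t) (g s))) //.
  exact: smooth_euclid_differentiable.
by apply: differentiable_in_charts; [exact: phi_cod|rewrite phiK//; exact: dom_center].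
Qed.

Lemma tangent_fibre_vertical k (g : 'rV[R]_k -> M) b t w : smooth_euclid g ->
  (forall s, f (g s) = b) -> vertical f (g t) (tangent_euclid g t w).
Proof.
move=> sg fg; rewrite /vertical tangent_map_comp//.
by under eq_fun do rewrite !fg; exact: derive_cst.
Qed.

End TangentMap.

Lemma coeff_update (K : Type) (R : realType) m k (M : manifold R m) (theta : form K M k)
    (p : M) w i u y :
  coeff theta p (update w i u) y =
  theta (psi p y) (update (fun j => tangent_euclid (psi p) y (w j)) i
    (tangent_euclid (psi p) y u)).
Proof.
by congr (theta _ _); apply/funext => j; rewrite /update; case: eqP.
Qed.

Section SmoothForm.
Context {R : realType} {m k : nat} {M : manifold R m} (theta : form R M k).
Hypothesis sth : smooth_form theta.

Lemma form_multilinear x : multilinear (theta x).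
Proof. by case: sth => mth _ _ w i c u v; exact: mth. Qed.

Lemma form_alternating x : alternating (theta x).
Proof. by case: sth => _ ath _ w i j; exact: ath. Qed.

Lemma coeff_multilinear (p : M) y : cod p y -> multilinear (fun w => coeff theta p w y).
Proof.
move=> py w i c u v; rewrite !coeff_update (tangent_psi_linear c u v py).
exact: (@form_multilinear _ (fun j => tangent_euclid (psi p) y (w j)) i).
Qed.

Lemma coeff_alternating (p : M) y : alternating (fun w => coeff theta p w y).
Proof.
move=> w i j ij wij.
exact: (@form_alternating _ (fun i => tangent_euclid (psi p) y (w i)) i j ij
  (congr1 (tangent_euclid (psi p) y) wij)).
Qed.

Lemma coeff_C1 (p : M) y w : cod p y -> C1 (coeff theta p w) y.
Proof.
move=> py; case: sth => _ _ /(_ p w) sth'.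
have := @C1_entry _ _ _ _ _ _ 0 0 (smooth_on_C1 (near_cod py) sth').
by under eq_fun do rewrite mxE eqxx mulr1n.
Qed.

End SmoothForm.

(** * Contraction of a closed form along the fibres *)

Section Contraction.
Context {R : realType} {m l n : nat} {M : manifold R m} {N : manifold R l} (f : M -> N).
Context (theta : form R M n.+1) (b : N).
Hypothesis fsm : smooth_map setT f.
Hypothesis sth : smooth_form theta.
Hypothesis cth : closed_form theta.
Hypothesis vth : forall x w, submersive f x -> (forall i, vertical f x (w i)) -> theta x w = 0.
Hypothesis subb : forall x, f x = b -> submersive f x.

(** Two lifts of v differ by a vertical vector, and theta vanishes on vertical arguments. *)
Lemma contractE v x w u : submersive f x -> (forall i, vertical f x (w i)) ->
  tangent_map f x u = v -> contract f v theta x w = theta x (fcons u w).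
Proof.
move=> sx vw uv; rewrite /contract; set u' := xget _ _.
have u'v : tangent_map f x u' = v by apply: (xgetPex (0 : 'rV[R]_m) (sx v)).
have := multilinearB (fcons 0 w) ord0 u' u (form_multilinear sth x).
rewrite !update_fcons0 => /esym D; apply/eqP; rewrite -subr_eq0 D; apply/eqP.
apply: vth => // i; case: (unliftP ord0 i) => [j|] ->.
  by rewrite fcons_lift.
rewrite fcons0 /vertical addrC -scaleN1r (tangent_map_linear fsm) u'v uv scaleN1r.
by rewrite addNr.
Qed.

Lemma tangent_map_chart_center (p : M) y u : cod p y -> f (psi p y) = b ->
  tangent_map f (psi p y) (tangent_euclid (psi p) y u) = 'D_u (in_charts f p b) y.
Proof.
move=> py fb; have bp : dom b (f (psi p y)) by rewrite fb; exact: dom_center.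
rewrite (tangent_map_chart fsm u py bp) fb.
have E : \forall z \near phi b b, phi b (psi b z) = z.
  by apply: filterS (near_cod (phi_cod (dom_center b))) => z bz; rewrite psiK.
by rewrite (near_eq_derive _ E) derive_id.
Qed.

Lemma submersive_in_charts (p : M) y : cod p y -> dom b (f (psi p y)) ->
  (forall w, exists u, 'D_u (in_charts f p b) y = w) -> submersive f (psi p y).
Proof.
move=> py bp surjF v.
have bfy := phi_cod bp; have fyc := dom_center (f (psi p y)).
have := @transition_surjective _ _ _ b (f (psi p y)) (phi b (f (psi p y))) v bfy.
rewrite phiK// => /(_ fyc) [z <-]; have [u uz] := surjF z.
by exists (tangent_euclid (psi p) y u); rewrite (tangent_map_chart fsm u py bp) uz.
Qed.

Lemma contract_closed k (g : 'rV[R]_k -> M) v t (e : 'I_n.+1 -> 'rV[R]_k) :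
  smooth_euclid g -> (forall s, f (g s) = b) ->
  let gamma (i : 'I_n.+1) s :=
    contract f v theta (g s) (fun j => tangent_euclid g s (e (lift i j))) in
  (forall i, C1 (gamma i) t) /\ \sum_(i < n.+1) (-1) ^+ i * 'D_(e i) (gamma i) t = 0.
Proof.
move=> sg fg gamma; pose p := g t; pose G s := phi p (g s).
have cg s : {for s, continuous g} by case: sg => cg _; exact: cg.
have pt : dom p (g t) := dom_center p.
pose y := G t; have py : cod p y by exact: phi_cod.
have psiy : psi p y = p by rewrite /y /G phiK.
have bp : dom b (f (psi p y)) by rewrite psiy fg; exact: dom_center.
have [S [yS sS]] := smooth_in_charts fsm py bp.
have ng := near_dom (cg t) pt.
have fcy : {for y, continuous (fun z => f (psi p z))} := continuous_map_psi fsm py.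
pose theta' z w := coeff theta p w z.
have dG s : dom p (g s) -> differentiable G s by exact: smooth_euclid_differentiable.
have vG s w : dom p (g s) -> 'D_('D_w G s) (in_charts f p b) (G s) = 0.
  move=> ps; rewrite -(derive_comp (f := in_charts f p b) (g := G)); last 2 first.
  - exact: dG.
  - by apply: differentiable_in_charts => //; [exact: phi_cod|rewrite phiK// fg; exact: dom_center].
  have E : \forall r \near s, phi b b = in_charts f p b (G r).
    by apply: filterS (near_dom (cg s) ps) => r pr; rewrite /in_charts /G phiK// fg.
  by rewrite -(near_eq_derive w E) derive_cst.
have surjF w : exists u, 'D_u (in_charts f p b) y = w.
  have [u uw] := subb (fg t) w; have [u' u'u] := tangent_psi_surjective u py.
  exists u'; rewrite -tangent_map_chart_center//; last by rewrite psiy; exact: fg.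
  by rewrite u'u psiy.
have CF := smooth_on_C1 yS sS.
have C2F u := smooth_on_C1_derive u yS sS.
(* Submersivity is an open condition. It is needed off the fibre over b, since the vanishing of
   theta on neighbouring fibres is available only at submersive points. *)
have nsurj : \forall z \near y, forall w, exists u, 'D_u (in_charts f p b) z = w.
  have [L [_ LF]] := local_section CF C2F surjF.
  by apply: filterS LF => z LFz w; exists (w *m L z); exact: LFz.
have ncharts : \forall z \near y, cod p z /\ dom b (f (psi p z)).
  exact: filterI (near_cod py) (near_dom fcy bp).
apply: (@closed_contraction _ _ _ _ _ theta' (in_charts f p b) y v G t gamma e).
- by apply: filterS (near_cod py) => z pz; exact: coeff_multilinear.
- by apply: filterS (near_cod py) => z _; exact: coeff_alternating.
- by move=> w; exact: coeff_C1.
- by move=> w; exact: cth.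
- exact: CF.
- exact: C2F.
- exact: surjF.
- apply: filterS2 ncharts nsurj => z [pz bz] surjz w wv.
  apply: vth; first exact: submersive_in_charts.
  move=> i; rewrite /vertical (tangent_map_chart fsm _ pz bz) wv.
  exact: derive0.
- by [].
- case: sg => _ /(_ p) sg; exact: (smooth_on_C1 ng sg).
- by case: sg => _ /(_ p) sg w; exact: (smooth_on_C1_derive w ng sg).
- by move=> w; exact: vG.
- apply: filterS ng => s ps i u uv; rewrite /gamma.
  have psiG : psi p (G s) = g s by rewrite /G phiK.
  have pGs : cod p (G s) by exact: phi_cod.
  rewrite (contractE (u := tangent_euclid (psi p) (G s) u)); last 3 first.
  + by apply: subb; exact: fg.
  + by move=> j; exact: (tangent_fibre_vertical fsm _ _ sg fg).
  + by rewrite -psiG tangent_map_chart_center// psiG; exact: fg.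
  rewrite -psiG /theta' /coeff /pullback; congr theta; apply/funext => j.
  case: (unliftP ord0 j) => [j'|] ->; last by rewrite !fcons0.
  rewrite !fcons_lift.
  exact: (tangent_euclid_chart _ (cg s) ps (dG s ps)).
Qed.

End Contraction.

(** * Affine reparametrisation: faces and subtori *)

Section AffineCubes.
Context {R : realType} {m : nat} {M : manifold R m}.

Lemma affine_line k k' (A : 'M[R]_(k, k')) (c : 'rV[R]_k') (x v : 'rV[R]_k) (h : R) :
  (h *: v + x) *m A + c = h *: (v *m A) + (x *m A + c).
Proof. by rewrite mulmxDl -scalemxAl addrA. Qed.

Lemma iter_derive_affine k k' l (A : 'M[R]_(k, k')) (c : 'rV[R]_k') (vs : seq 'rV[R]_k)
    (g : 'rV[R]_k' -> 'rV[R]_l) :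
  iter_derive vs (fun x => g (x *m A + c)) =
  (fun x => iter_derive [seq v *m A | v <- vs] g (x *m A + c)).
Proof.
elim: vs g => //= v vs IH g; rewrite -IH; congr iter_derive.
apply/funext => x; exact: (derive_affine g (fun h => affine_line A c x v h)).
Qed.

Lemma smooth_euclid_affine k k' (A : 'M[R]_(k, k')) (c : 'rV[R]_k') (g : 'rV[R]_k' -> M) :
  smooth_euclid g -> smooth_euclid (fun x => g (x *m A + c)).
Proof.
have CA x : C1 (fun x => x *m A + c) x.
  apply: C1D; last exact: C1_cst.
  apply: C1_mulmx; last exact: C1_cst.
  split; first by near=> y; exact: ex_diff.
  move=> v; have -> : 'D_v (@id 'rV[R]_k) = cst v by apply/funext => y; exact: derive_id.
  exact: cst_continuous.
move=> [cg sg]; split=> [|q vs x qx].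
  have cA : continuous (fun x : 'rV[R]_k => x *m A + c) by move=> x; exact: C1_continuous (CA x).
  exact: continuous_compose cA cg.
rewrite (iter_derive_affine A c vs (fun y => phi q (g y))).
apply: (@differentiable_comp _ _ _ _ (fun x => x *m A + c) (iter_derive _ _)).
  exact: C1_differentiable (CA x).
exact: sg.
Unshelve. all: by end_near. Qed.

Lemma ins_mulmx k (i : 'I_k.+1) (e : R) (t : 'rV[R]_k) :
  ins i e t = t *m row' i 1%:M + e *: delta_mx 0 i.
Proof.
apply/rowP => j; rewrite !mxE; case: (unliftP i j) => [j'|] -> /=.
  rewrite eq_sym (negbTE (neq_lift i j')) mulr0 addr0 (bigD1 j')//= !mxE eqxx mulr1 big1 ?addr0//.
  by move=> l lj; rewrite !mxE (inj_eq lift_inj) (negbTE lj) mulr0.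
rewrite eqxx mulr1 big1 ?add0r// => l _.
by rewrite !mxE eq_sym (negbTE (neq_lift i l)) mulr0.
Qed.

Lemma delta_row' k (i : 'I_k.+1) (j : 'I_k) :
  delta_mx 0 j *m row' i 1%:M = delta_mx 0 (lift i j) :> 'rV[R]_k.+1.
Proof. by rewrite -rowE; apply/rowP => l; rewrite !mxE eq_sym. Qed.

Lemma faceE k (i : 'I_k.+1) (e : R) (g : 'rV[R]_k.+1 -> M) :
  face i e g = (fun t => g (t *m row' i 1%:M + e *: delta_mx 0 i)).
Proof. by apply/funext => t; rewrite -ins_mulmx. Qed.

Lemma smooth_face k (i : 'I_k.+1) (e : R) (g : 'rV[R]_k.+1 -> M) :
  smooth_euclid g -> smooth_euclid (face i e g).
Proof. by rewrite faceE; exact: smooth_euclid_affine. Qed.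

Lemma tangent_affine k k' (A : 'M[R]_(k, k')) (c : 'rV[R]_k') (g : 'rV[R]_k' -> M) t w :
  tangent_euclid (fun x => g (x *m A + c)) t w = tangent_euclid g (t *m A + c) (w *m A).
Proof.
exact: (derive_affine (fun s => phi (g (t *m A + c)) (g s)) (fun h => affine_line A c t w h)).
Qed.

Lemma tangent_face k (i : 'I_k.+1) (e : R) (g : 'rV[R]_k.+1 -> M) t j :
  tangent_euclid (face i e g) t (delta_mx 0 j) =
  tangent_euclid g (ins i e t) (delta_mx 0 (lift i j)).
Proof. by rewrite faceE tangent_affine -ins_mulmx delta_row'. Qed.

Lemma torus_cubeE k l (Phi : 'rV[R]_l -> M) (A : 'M[R]_(k, l)) :
  torus_cube Phi A = (fun t => Phi (t *m A + 0)).
Proof. by apply/funext => t; rewrite addr0. Qed.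

Lemma smooth_torus_cube k l (Phi : 'rV[R]_l -> M) (A : 'M[R]_(k, l)) :
  smooth_euclid Phi -> smooth_euclid (torus_cube Phi A).
Proof. by rewrite torus_cubeE; exact: smooth_euclid_affine. Qed.

Lemma tangent_torus_cube k l (Phi : 'rV[R]_l -> M) (A : 'M[R]_(k, l)) t i :
  tangent_euclid (torus_cube Phi A) t (delta_mx 0 i) = tangent_euclid Phi (t *m A) (row i A).
Proof. by rewrite torus_cubeE tangent_affine addr0 rowE. Qed.

Lemma face_torus_cube k l (Phi : 'rV[R]_l -> M) (A : 'M[R]_(k.+1, l)) i :
  face i 0 (torus_cube Phi A) = torus_cube Phi (row' i A).
Proof.
rewrite faceE /torus_cube; apply/funext => t.
rewrite scale0r addr0 -mulmxA; congr (Phi (_ *m _)).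
have rr p (B : 'M[R]_(k.+1, p)) j : row j (row' i B) = row (lift i j) B.
  by apply/rowP => q; rewrite !mxE.
by apply/row_matrixP => j; rewrite row_mul !rr -row_mul mul1mx.
Qed.

End AffineCubes.

(** * Stokes' theorem for a cube in a fibre *)

Section Stokes.
Context {R : realType} {m l n : nat} {M : manifold R m} {N : manifold R l} (f : M -> N).
Context (theta : form R M n.+1) (b : N).
Hypothesis fsm : smooth_map setT f.
Hypothesis sth : smooth_form theta.
Hypothesis cth : closed_form theta.
Hypothesis vth : forall x w, submersive f x -> (forall i, vertical f x (w i)) -> theta x w = 0.
Hypothesis subb : forall x, f x = b -> submersive f x.
Variable v : 'rV[R]_l.
Notation eta := (contract f v theta).

Lemma continuous_contract (g : 'rV[R]_n -> M) : smooth_euclid g -> (forall s, f (g s) = b) ->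
  continuous (fun t => pullback g eta t (fun i => delta_mx 0 i)).
Proof.
move=> sg fg t.
(* The leading 0 is a filler: the coefficient of index [ord0] omits it and leaves the n coordinate
   directions. *)
have [Cg _] := contract_closed fsm sth cth vth subb v t
  (fcons 0 (fun i => delta_mx 0 i)) sg fg.
suff -> : (fun t => pullback g eta t (fun i => delta_mx 0 i)) = (fun s => eta (g s)
    (fun j => tangent_euclid g s (fcons 0 (fun i => delta_mx 0 i) (lift ord0 j)))).
  exact: C1_continuous (Cg ord0).
apply/funext => s; rewrite /pullback; congr (eta _ _); apply/funext => j.
by rewrite fcons_lift.
Qed.

Variable g : 'rV[R]_n.+1 -> M.
Hypotheses (sg : smooth_euclid g) (fg : forall s, f (g s) = b).

Definition omit_coeff (i : 'I_n.+1) (t : 'rV[R]_n.+1) : R :=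
  eta (g t) (fun j => tangent_euclid g t (delta_mx 0 (lift i j))).

Lemma C1_omit_coeff i t : C1 (omit_coeff i) t.
Proof.
have [Cg _] := contract_closed fsm sth cth vth subb v t (fun i => delta_mx 0 i) sg fg.
exact: (Cg i).
Qed.

Lemma omit_coeff_closed t : \sum_(i < n.+1) (-1) ^+ i * 'D_(delta_mx 0 i) (omit_coeff i) t = 0.
Proof.
have [_ Cg] := contract_closed fsm sth cth vth subb v t (fun i => delta_mx 0 i) sg fg.
exact: Cg.
Qed.

Lemma int_cube_face i e :
  int_cube (face i e g) eta = cube_integral (fun y => omit_coeff i (ins i e y)).
Proof.
rewrite /int_cube; congr cube_integral; apply/funext => t; rewrite /pullback /omit_coeff.
by congr (eta _ _); apply/funext => j; rewrite tangent_face.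
Qed.

Lemma cube_omit_coeff i : cube_integral (omit_coeff i) =
  \int[@lebesgue_measure R]_(s in `[0, 1]) int_cube (face i s g) eta.
Proof.
rewrite (cube_integral_slice i); last by move=> t; exact: C1_continuous (C1_omit_coeff i t).
by apply: eq_Rintegral => s _; rewrite int_cube_face.
Qed.

(** Each difference of opposite faces is the integral of a partial derivative, and the signed sum of
    the integrands is zero at every point by [omit_coeff_closed]. *)
Lemma stokes_cube :
  \sum_(i < n.+1) (-1) ^+ i * (int_cube (face i 1 g) eta - int_cube (face i 0 g) eta) = 0.
Proof.
transitivity (\sum_(i < n.+1) (-1) ^+ i * cube_integral ('D_(delta_mx 0 i) (omit_coeff i))).
  apply: eq_bigr => i _; congr (_ * _); rewrite !int_cube_face cube_integral_derive//.
  - by move=> t; exact: C1_continuous (C1_omit_coeff i t).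
  - by move=> t; exact: diff_derivable (C1_differentiable (C1_omit_coeff i t)).
  - by move=> t; have [_] := C1_omit_coeff i t; apply.
rewrite -(cube_integral_sum _ (fun i : 'I_n.+1 => (-1) ^+ i)); last first.
  by move=> i t; have [_] := C1_omit_coeff i t; apply.
by under eq_fun do rewrite omit_coeff_closed; exact: cube_integral_cst.
Qed.

End Stokes.

(** * Cubical chains *)

Section Chains.
Context {R : realType}.

(** From any point of the cube, boundary points included, a segment in direction +e_j or -e_j stays
    in the cube. The two-sided derivative exists, so it equals the one-sided one, which sees only
    values on the cube. *)
Lemma derive_unit_cube0 k (W : normedModType R) (f : 'rV[R]_k -> W) (t : 'rV[R]_k) (j : 'I_k) :
  unit_cube t -> derivable f t (delta_mx 0 j) ->
  (forall h : R, unit_cube (h *: delta_mx 0 j + t) -> f (h *: delta_mx 0 j + t) = f t) ->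
  'D_(delta_mx 0 j) f t = 0.
Proof.
move=> ut df fE.
have unit h : 0 <= h + t 0 j <= 1 -> unit_cube (h *: delta_mx 0 j + t).
  move=> hj i; rewrite !mxE eqxx /=; case: (eqVneq i j) => [->|_].
    by rewrite mulr1.
  by rewrite mulr0 add0r.
have := ut j; rewrite le_eqVlt => /andP[/orP[/eqP t0|t0] t1].
  rewrite /derive cvg_at_rightE//; apply: lim_near_cst; first exact: norm_hausdorff.
  near=> h; rewrite /= fE ?subrr ?scaler0//; apply: unit.
  by rewrite -t0 addr0 ltW//=; near: h; exact: nbhs_right_le.
rewrite /derive cvg_at_leftE//; apply: lim_near_cst; first exact: norm_hausdorff.
near=> h; rewrite /= fE ?subrr ?scaler0//; apply: unit.
have h0 : h < 0 by near: h; exact: nbhs_left_lt.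
apply/andP; split; last by rewrite (le_trans _ t1)// gerDr ltW.
by rewrite -lerBlDr sub0r; near: h; apply: nbhs_left_ge; rewrite oppr_lt0.
Unshelve. all: by end_near. Qed.

Context {m : nat} {M : manifold R m}.

Lemma tangent_unit_cube_eq k (g h : 'rV[R]_k -> M) t j :
  smooth_euclid g -> smooth_euclid h -> (forall s, unit_cube s -> g s = h s) ->
  unit_cube t ->
  tangent_euclid g t (delta_mx 0 j) = tangent_euclid h t (delta_mx 0 j).
Proof.
move=> sg sh gh ut; rewrite /tangent_euclid -(gh t ut).
have px := dom_center (g t).
have dg : derivable (fun s => phi (g t) (g s)) t (delta_mx 0 j).
  exact: diff_derivable (smooth_euclid_differentiable sg px).
have dh : derivable (fun s => phi (g t) (h s)) t (delta_mx 0 j).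
  by apply/diff_derivable/(smooth_euclid_differentiable sh); rewrite -gh.
apply/eqP; rewrite -subr_eq0 -(deriveB dg dh); apply/eqP.
apply: (derive_unit_cube0 ut (derivableB dg dh)).
move=> r ur; rewrite -[LHS]/(phi (g t) (g (r *: delta_mx 0 j + t)) -
  phi (g t) (h (r *: delta_mx 0 j + t))).
by rewrite -[RHS]/(phi (g t) (g t) - phi (g t) (h t)) !gh// !subrr.
Qed.

Lemma int_cube_unit_cube_eq k (g h : 'rV[R]_k -> M) (eta : form R M k) :
  smooth_euclid g -> smooth_euclid h -> (forall s, unit_cube s -> g s = h s) ->
  int_cube g eta = int_cube h eta.
Proof.
move=> sg sh gh; apply: eq_cube_integral => t; rewrite inE => ut.
rewrite /pullback (gh t ut); congr (eta _ _); apply/funext => j.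
exact: tangent_unit_cube_eq.
Qed.

Lemma int_cube_degenerate k (g : 'rV[R]_k -> M) (eta : form R M k) :
  (forall x w i, w i = 0 -> eta x w = 0) ->
  smooth_euclid g -> degenerate g -> int_cube g eta = 0.
Proof.
move=> eta0 sg [i gi]; rewrite -[RHS](@cube_integral_cst R k 0).
apply: eq_cube_integral => t; rewrite inE => ut.
apply: (eta0 _ _ i); apply: derive_unit_cube0 => //.
  exact: diff_derivable (smooth_euclid_differentiable sg (dom_center (g t))).
move=> h uh; congr phi; apply: gi => // j ji.
by rewrite !mxE eqxx (negbTE ji) mulr0 add0r.
Qed.

(** Induction on the length: the cubes agreeing with the first one on the unit cube are collected.
    Their coefficients add up to its multiplicity, which is zero unless the cube is degenerate, and
    then I vanishes on it. *)
Lemma chain_null_sum k (Q : ('rV[R]_k -> M) -> Prop) (I : ('rV[R]_k -> M) -> R) (c : chain M k) :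
  (forall g h, Q g -> Q h -> (forall s, unit_cube s -> g s = h s) -> I g = I h) ->
  (forall g, Q g -> degenerate g -> I g = 0) ->
  all (fun p => `[< Q p.2 >]) c -> chain_null c ->
  \sum_(p <- c) p.1%:~R * I p.2 = 0.
Proof.
move=> Ieq Ideg; have [r] := ubnP (size c); elim: r c => // r IH [|p0 c0] cr Qc nc.
  by rewrite big_nil.
set c := p0 :: c0.
pose a (p : int * ('rV[R]_k -> M)) := `[< forall t, unit_cube t -> p.2 t = p0.2 t >].
have ap0 : a p0 by apply/asboolP.
have Qp0 : Q p0.2 by move: Qc => /= /andP[/asboolP].
rewrite (bigID a)/=.
have -> : \sum_(p <- c | a p) p.1%:~R * I p.2 = 0.
  have -> : \sum_(p <- c | a p) p.1%:~R * I p.2 = (chain_mult c p0.2)%:~R * I p0.2.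
    rewrite /chain_mult -big_mkcond/= rmorph_sum/= mulr_suml.
    have : all (fun p => `[< Q p.2 >]) c := Qc.
    elim: (c) => [|p c' IHc] /=; first by rewrite !big_nil.
    move=> /andP[/asboolP Qp Qc']; rewrite !big_cons IHc// -/(a p).
    by case: ifP => // /asboolP ap; rewrite (Ieq _ _ Qp Qp0 ap).
  have [dg|ndg] := pselect (degenerate p0.2); first by rewrite Ideg ?mulr0.
  by rewrite nc// mul0r.
rewrite add0r -big_filter; apply: IH.
- rewrite /c /= ap0 /= size_filter.
  exact: (leq_ltn_trans (count_size _ _) (cr : (size c0 < r)%N)).
- by rewrite all_filter; apply: sub_all Qc => p Qp; apply/implyP.
(* Removing the class keeps the chain null: a cube g in that class now has multiplicity 0, and for
   any other g nothing was removed. *)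
- move=> g ndg; rewrite /chain_mult big_filter.
  have [ag|nag] := pselect (forall t, unit_cube t -> p0.2 t = g t).
    apply: big1 => p /asboolP np; case: ifP => // /asboolP pg; exfalso; apply: np => t ut.
    by rewrite pg// ag.
  rewrite -[RHS](nc g ndg) /chain_mult [RHS](bigID a)/= [X in _ = X + _]big1 ?add0r//.
  move=> p /asboolP ap; case: ifP => // /asboolP pg; exfalso; apply: nag => t ut.
  by rewrite -ap// pg.
Qed.

Lemma int_chain_cat k (c d : chain M k) (eta : form R M k) :
  int_chain (c ++ d) eta = int_chain c eta + int_chain d eta.
Proof. exact: big_cat. Qed.

Lemma int_chain_opp k (c : chain M k) (eta : form R M k) :
  int_chain (chain_opp c) eta = - int_chain c eta.
Proof.
rewrite /int_chain /chain_opp big_map -sumrN; apply: eq_bigr => p _ /=.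
by rewrite mulrNz mulNr.
Qed.

Lemma int_chain_boundary k (d : chain M k.+1) (eta : form R M k) :
  int_chain (boundary d) eta = \sum_(p <- d) p.1%:~R *
    \sum_(i < k.+1) (-1) ^+ i * (int_cube (face i 1 p.2) eta - int_cube (face i 0 p.2) eta).
Proof.
rewrite /int_chain /boundary big_flatten big_map; apply: eq_bigr => p _.
rewrite big_flatten big_map enumT mulr_sumr; apply: eq_bigr => i _.
rewrite !big_cons big_nil /= addr0 mulrNz mulNr rmorphM/= rmorphXn/= rmorphN1.
by rewrite -!mulrBr mulrCA mulrA.
Qed.

End Chains.

(** * Invariance of the integral under homology *)

Section Homology.
Context {R : realType} {m l n : nat} {M : manifold R m} {N : manifold R l} (f : M -> N).
Context (theta : form R M n.+1) (b : N).
Hypothesis fsm : smooth_map setT f.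
Hypothesis sth : smooth_form theta.
Hypothesis cth : closed_form theta.
Hypothesis vth : forall x w, submersive f x -> (forall i, vertical f x (w i)) -> theta x w = 0.
Hypothesis subb : forall x, f x = b -> submersive f x.
Variable v : 'rV[R]_l.
Notation eta := (contract f v theta).

Lemma contract_eq0 x w i : w i = 0 -> eta x w = 0.
Proof.
move=> wi; rewrite /contract -(update_id w i) wi -update_fcons_lift.
exact: multilinear0 (form_multilinear sth x).
Qed.

Lemma chain_in_face (d : chain M n.+1) :
  chain_in (f @^-1` [set b]) d -> chain_in (f @^-1` [set b]) (boundary d).
Proof.
rewrite /chain_in /boundary => dA; elim: d dA => //= p d IH /andP[/asboolP[sp fp] dA].
rewrite all_cat IH// andbT; elim: (enum _) => //= i r -> /=; rewrite andbT.
apply/andP; split; apply/asboolP; split; do ?exact: smooth_face.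
all: by move=> t; exact: fp.
Qed.

Lemma int_chain_homologous (c c' : chain M n) :
  chain_in (f @^-1` [set b]) c -> chain_in (f @^-1` [set b]) c' ->
  homologous_in (f @^-1` [set b]) c c' ->
  int_chain c eta = int_chain c' eta.
Proof.
move=> cA c'A [d [dA]] /chain_null_sum nul.
have : int_chain (c ++ chain_opp (c' ++ boundary d)) eta = 0.
  apply: (nul (fun g => smooth_euclid g /\ forall t, (f @^-1` [set b]) (g t))
    (fun g => int_cube g eta)).
  - by move=> g h [sg _] [sh _]; exact: int_cube_unit_cube_eq.
  - by move=> g [sg _]; apply: int_cube_degenerate => //; exact: contract_eq0.
  - by rewrite all_cat all_map all_cat; apply/and3P; split => //; exact: chain_in_face.
rewrite int_chain_cat int_chain_opp int_chain_cat int_chain_boundary.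
have -> : \sum_(p <- d) p.1%:~R * (\sum_(i < n.+1) (-1) ^+ i *
    (int_cube (face i 1 p.2) eta - int_cube (face i 0 p.2) eta)) = 0.
  elim: d dA {nul} => [|p d IH]; first by rewrite big_nil.
  rewrite /chain_in /= => /andP[/asboolP[sp fp] dA]; rewrite big_cons IH// addr0.
  by rewrite (stokes_cube fsm sth cth vth subb v sp fp) mulr0.
by rewrite addr0 => /eqP; rewrite subr_eq0 => /eqP.
Qed.

End Homology.

(** * Closedness of the holomorphic volume form *)

Section ExteriorDerivative.
Context {R : realType} {m k : nat} {M : manifold R m}.

Definition dcoeff (theta : form R M k) (p : M) (y : 'rV[R]_m) (w : 'I_k.+1 -> 'rV[R]_m) : R :=
  \sum_(i < k.+1) (-1) ^+ i * 'D_(w i) (coeff theta p (fun j => w (lift i j))) y.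

Context (theta : form R M k) (p : M) (y : 'rV[R]_m).
Hypotheses (sth : smooth_form theta) (py : cod p y).

Lemma derive_coeff_multilinear u : multilinear (fun w => 'D_u (coeff theta p w) y).
Proof.
move=> w i c a b.
have E : \forall z \near y, c * coeff theta p (update w i a) z + coeff theta p (update w i b) z =
    coeff theta p (update w i (c *: a + b)) z.
  by apply: filterS (near_cod py) => z pz; rewrite (coeff_multilinear sth pz).
have Ca := coeff_C1 sth (update w i a) py; have Cb := coeff_C1 sth (update w i b) py.
apply: etrans (esym (near_eq_derive u E)) _.
have Cc : C1 (fun _ : 'rV[R]_m => c) y by exact: C1_cst.
have -> : (fun z => c * coeff theta p (update w i a) z + coeff theta p (update w i b) z) =
  ((fun z => c * coeff theta p (update w i a) z) : 'rV[R]_m -> R) +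
    coeff theta p (update w i b) by [].
rewrite deriveD; last 2 first.
- exact/diff_derivable/C1_differentiable/C1M.
- exact/diff_derivable/C1_differentiable.
by rewrite (derive_mul u Cc Ca) derive_cst mulr0 addr0.
Qed.

Lemma derive_coeff_alternating u : alternating (fun w => 'D_u (coeff theta p w) y).
Proof.
move=> w i j ij wij; have -> : coeff theta p w = cst 0.
  by apply/funext => z; exact: (@coeff_alternating _ _ _ _ _ sth p z w i j ij wij).
exact: derive_cst.
Qed.

Lemma lift_case (i l : 'I_k.+1) : l != i -> exists i', i = lift l i'.
Proof. by case: (unliftP l i) => [i' ->|->]; [exists i'|rewrite eqxx]. Qed.

Lemma dcoeff_multilinear : multilinear (dcoeff theta p y).
Proof.
move=> w i c a b; rewrite /dcoeff mulr_sumr -big_split/=; apply: eq_bigr => l _.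
rewrite mulrCA -mulrDr; congr (_ * _).
have [->|/lift_case[i' ->]] := eqVneq l i.
  rewrite !update_same !update_lift derive_linear//.
  exact: C1_differentiable (coeff_C1 sth _ py).
have ll x : update w (lift l i') x l = w l by rewrite update_neq// neq_lift.
rewrite !ll !(update_comp w _ _ (@lift_inj _ l)).
exact: derive_coeff_multilinear.
Qed.

Lemma dcoeff_alternating : alternating (dcoeff theta p y).
Proof.
move=> w i j; apply: (@sum_omit_alternate _ _ _ (fun u w => 'D_u (coeff theta p w) y)) => u.
  exact: derive_coeff_multilinear.
exact: derive_coeff_alternating.
Qed.

End ExteriorDerivative.

Section Holomorphic.
Context {R : realType} {n : nat} (X : calabi_yau R n).

Lemma Jstd_delta (j : 'I_n) :
  Jstd (delta_mx 0 (lshift n j)) = delta_mx 0 (rshift n j) :> 'rV[R]_(n + n).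
Proof.
apply/rowP => i; rewrite /Jstd; case: (split_ordP i) => i' ->.
  by rewrite row_mxEl !mxE eq_lrshift eq_rlshift oppr0.
by rewrite row_mxEr !mxE eq_lshift eq_rshift.
Qed.

Lemma coeff_J (p : X) w i u y : cod p y ->
  coeff (Omega X) p (update w i (Jstd u)) y = Complex 0 1 * coeff (Omega X) p (update w i u) y.
Proof.
move=> py; rewrite !coeff_update -Omega_J; congr (Omega X _ (update _ _ _)).
by rewrite !tangent_psi cy_holomorphic_atlas//; exact: dom_center.
Qed.

Lemma coeff_im_J (p : X) w i u y : cod p y ->
  coeff (im_form (Omega X)) p (update w i (Jstd u)) y =
  coeff (re_form (Omega X)) p (update w i u) y.
Proof.
move=> py.
rewrite -[LHS]/(complex.Im (coeff (Omega X) p (update w i (Jstd u)) y)) (coeff_J w i u py).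
rewrite -[RHS]/(complex.Re (coeff (Omega X) p (update w i u) y)).
by case: (coeff _ _ _ _) => a b /=; rewrite mul0r mul1r add0r.
Qed.

(** When slot i is the direction of differentiation this is a Cauchy-Riemann equation; when it is an
    argument of the form it is complex linearity of Omega. *)
Lemma dcoeff_im_J (p : X) w i u y : cod p y ->
  dcoeff (im_form (Omega X)) p y (update w i (Jstd u)) =
  dcoeff (re_form (Omega X)) p y (update w i u).
Proof.
move=> py; apply: eq_bigr => l _; congr (_ * _).
have [->|/lift_case[i' ->]] := eqVneq l i.
  rewrite !update_same !update_lift.
  by have [_] := @Omega_holomorphic _ _ X p (fun j => w (lift i j)) y u py.
have ll x : update w (lift l i') x l = w l by rewrite update_neq// neq_lift.
rewrite !ll !(update_comp w _ _ (@lift_inj _ l)); apply: near_eq_derive.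
by apply: filterS (near_cod py) => z pz; exact: coeff_im_J.
Qed.

(* d Omega is complex-linear and alternating; among n + 1 vectors of the real basis
   (e_j, i e_j) of C^n two share the same j, so it vanishes on them. *)
Lemma im_Omega_closed : closed_form (im_form (Omega X)).
Proof.
move=> p y w py; rewrite -[LHS]/(dcoeff (im_form (Omega X)) p y w).
have sI := @Omega_im_smooth _ _ X; have sR := @Omega_re_smooth _ _ X.
have aI := dcoeff_alternating sI py; have aR := dcoeff_alternating sR py.
apply: multilinear_basis; first exact: dcoeff_multilinear.
move=> f; pose h i := match fintype.split (f i) with inl j => j | inr j => j end.
have [a [b [ab hab]]] : exists a b, a != b /\ h a = h b.
  have /injectivePn[a [b ab hab]] : ~~ injectiveb h.
    apply/negP => /injectiveP/leq_card; by rewrite !card_ord ltnn.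
  by exists a, b.
(* Replacing i e_j by e_j turns d Im Omega into d Re Omega, which then has e_j in two slots. *)
have main a' b' j : a' != b' -> f a' = lshift n j -> f b' = rshift n j ->
    dcoeff (im_form (Omega X)) p y (fun i => delta_mx 0 (f i)) = 0.
  move=> ab' fa fb; set e := (fun i => delta_mx 0 (f i)).
  rewrite -(update_id e b') [e b']/e fb -Jstd_delta dcoeff_im_J//.
  by apply: (aR _ _ _ ab'); rewrite update_same update_neq// /e fa.
move: hab; rewrite /h.
case: (split_ordP (f a)) => j fa; case: (split_ordP (f b)) => j' fb /= jj.
- by apply: (aI _ _ _ ab); rewrite fa fb jj.
- by apply: (main a b j) => //; rewrite jj.
- by apply: (main b a j) => //; rewrite ?jj// eq_sym.
- by apply: (aI _ _ _ ab); rewrite fa fb jj.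
Qed.

End Holomorphic.

(** * Periods of the special Lagrangian fibre *)

(** The n! orderings of the arguments of b contribute equally and cancel the normalising factor of
    [wedge]. *)
Lemma wedge_one (R : realType) m n (M : manifold R m) (a : form R M 1) (b : form R M n) x
    (w : 'I_n.+1 -> 'rV[R]_m) :
  multilinear (b x) -> alternating (b x) ->
  wedge a b x w = \sum_(i < n.+1) (-1) ^+ i * (a x (fun=> w i) * b x (fun j => w (lift i j))).
Proof.
move=> mb ab; rewrite /wedge; have -> : (1`! * n`!)%N = n`! by rewrite mul1n.
have /= := sum_perm_lift (B := fun i phi => a x (fun=> w i) * b x (fun j => w (phi j))).
move=> /(_ _) E; rewrite [X in _ * X](_ : _ = n`!%:R * \sum_(i < n.+1) (-1) ^+ i *
    (a x (fun=> w i) * b x (fun j => w (lift i j)))).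
  by rewrite mulKf// pnatr_eq0 -leqn0 leqNgt fact_gt0.
rewrite -E; last first.
  by move=> i phi s; rewrite (alternating_perm (fun j => w (phi j)) s mb ab) mulrCA.
apply: eq_bigr => s _; rewrite -mulrA; congr (_ * (a x _ * b x _)).
  by apply/funext => i; rewrite ord1; congr (w (s _)); apply: val_inj.
by apply/funext => j; congr (w (s _)); apply: val_inj.
Qed.

Lemma Im_divr (R : realType) (z : complex R) (P : R) :
  complex.Im (z / Complex P 0) = complex.Im z * P^-1.
Proof.
case: z => x y.
rewrite -[LHS]/(x * - (0 / (P ^+ 2 + 0 ^+ 2)) + y * (P / (P ^+ 2 + 0 ^+ 2))).
rewrite expr0n addr0 mul0r oppr0 mulr0 add0r; congr (_ * _).
(* For P = 0 both sides are 0 by the convention 0^-1 = 0. *)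
have [->|P0] := eqVneq P 0; first by rewrite mul0r invr0.
by rewrite expr2 invfM mulVKf.
Qed.

Section Fibre.
Context {R : realType} {n : nat} {X : calabi_yau R n.+1} {B : manifold R n.+1} {f : X -> B}.
Hypothesis hf : slag_fibration f.
Context {b : B} (bB0 : B0 f b) (D : marking f b).

Let beta : form R X n.+1 := im_form (Omega X).

Let fsm : smooth_map setT f := fib_smooth hf.
Let sth : smooth_form beta := @Omega_im_smooth _ _ X.
Let cth : closed_form beta := @im_Omega_closed _ _ X.

Let vth x w : submersive f x -> (forall i, vertical f x (w i)) -> beta x w = 0.
Proof. exact: (fib_special hf). Qed.

Let subb x : f x = b -> submersive f x.
Proof. by move=> fx; apply: contrapT => nsub; apply: bB0; exists x. Qed.

Let fPhi alpha : f (Phi D alpha) = b.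
Proof.
rewrite -[f _ = b]/((f @^-1` [set b]) (Phi D alpha)) -(Phi_range D).
by exists alpha.
Qed.

Let sPhi k (A : 'M[R]_(k, n.+1)) : smooth_euclid (torus_cube (Phi D) A) :=
  smooth_torus_cube A (Phi_smooth D).

Let fcube k (A : 'M[R]_(k, n.+1)) t : f (torus_cube (Phi D) A t) = b := fPhi _.

Lemma row_basis_Lambda i : Lambda f b (row i (basis D)).
Proof.
apply/(basis_span D); exists (delta_mx 0 i).
by rewrite (map_delta_mx (intr : {rmorphism int -> R})) rowE.
Qed.

Lemma face_period (A : 'M[R]_n.+1) j : Lambda f b (row j A) ->
  face j 1 (torus_cube (Phi D) A) = face j 0 (torus_cube (Phi D) A).
Proof.
move=> Aj; rewrite !faceE; apply/funext => t; apply/(Phi_periods D).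
by rewrite -mulmxBl scale0r scale1r addr0 [_ + delta_mx _ _]addrC addrK -rowE.
Qed.

Variable v : 'rV[R]_n.+1.
Notation eta := (contract f v beta).

(* Stokes' theorem on the cube whose i-th edge is scaled by s: the faces transverse to the other
   edges cancel by periodicity. *)
Lemma int_cube_slice i s : int_cube (face i s (torus_cube (Phi D) (basis D))) eta =
  int_cube (torus_cube (Phi D) (row' i (basis D))) eta.
Proof.
(* S is diagonal with entry s in position i and 1 elsewhere. The upper i-th face of the rescaled
   cube is the slice at s, its lower face is the subtorus itself, and the other edges remain
   periods. *)
pose S := 1%:M + (s - 1) *: delta_mx i i : 'M[R]_n.+1.
pose A := S *m basis D.
have insS e t : ins i e t *m S = ins i (e * s) t.
  rewrite mulmxDr mulmx1 -scalemxAr.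
  have -> : ins i e t *m delta_mx i i = e *: delta_mx 0 i.
    apply/rowP => j; rewrite !mxE (bigD1 i)//= !mxE eqxx unlift_none/= big1 ?addr0//.
    by move=> l li; rewrite !mxE (negbTE li) mulr0.
  by rewrite !ins_mulmx -addrA scalerA -scalerDl; congr (_ + _ *: _); ring.
have faceS e : face i e (torus_cube (Phi D) A) = face i (e * s) (torus_cube (Phi D) (basis D)).
  by apply/funext => t; rewrite /face /torus_cube -!/(ins _ _ _) mulmxA insS.
have := stokes_cube fsm sth cth vth subb v (sPhi A) (fcube A).
rewrite (bigD1 i isT) [X in _ + X = _]big1; last first.
  move=> j; rewrite andTb => ji; rewrite face_period; first by rewrite subrr mulr0.
  have -> : row j A = row j (basis D).
    rewrite /A row_mul [row j (basis D)]rowE; congr (_ *m _).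
    by apply/rowP => l; rewrite !mxE (negbTE ji) mulr0 addr0 eqxx eq_sym.
  exact: row_basis_Lambda.
rewrite (faceS 1) (faceS 0) mul1r mul0r face_torus_cube addr0 => /eqP.
by rewrite mulf_eq0 signr_eq0 subr_eq0 => /eqP.
Qed.

Lemma h_period gamma : h D gamma v =
  \sum_(i < n.+1) (-1) ^+ i * pairing (row i (basis D)) gamma *
    int_cube (torus_cube (Phi D) (row' i (basis D))) eta.
Proof.
pose g := torus_cube (Phi D) (basis D).
have meta x : multilinear (eta x) by exact: (multilinear_fcons _ (form_multilinear sth x)).
have aeta x : alternating (eta x).
  exact: (alternating_fcons _ (@form_alternating _ _ _ _ _ sth x)).
(* [Phi_flow] has the flow vector in the first slot of omega, whereas the contraction puts the lift
   of gamma there; exchanging them yields the minus sign that cancels the one in [h]. *)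
have omegaE t i : contract f gamma (omega X) (g t) (fun=> tangent_euclid g t (delta_mx 0 i)) =
    - pairing (row i (basis D)) gamma.
  have sx : submersive f (g t) by apply: subb; exact: fcube.
  rewrite /contract; set u := xget _ _.
  have uv : tangent_map f (g t) u = gamma by apply: (xgetPex (0 : 'rV[R]_(n.+1 + n.+1)) (sx gamma)).
  rewrite tangent_torus_cube /g.
  have := @Phi_flow _ _ _ _ _ _ D (t *m basis D) (row i (basis D)) u.
  rewrite uv => <-; set tau := tangent_euclid _ _ _.
  have sw := alternating_tperm (pair2 u tau)
    (form_multilinear (@omega_smooth _ _ X) (Phi D (t *m basis D)))
    (@form_alternating _ _ _ _ _ (@omega_smooth _ _ X) (Phi D (t *m basis D)))
    (isT : ord0 != ord_max :> 'I_2).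
  rewrite -[LHS]/(omega X _ (pair2 u tau)) -[LHS]opprK -sw; congr (- omega X _ _).
  apply/funext => j; rewrite /pair2; case: (unliftP ord0 j) => [j'|] ->.
    rewrite ord1 fcons_lift.
    have -> : lift ord0 ord0 = ord_max :> 'I_2 by apply: val_inj.
    by rewrite tpermR fcons0.
  rewrite tpermL fcons0; have -> : ord_max = lift ord0 ord0 :> 'I_2 by apply: val_inj.
  by rewrite fcons_lift.
have cO i : continuous (omit_coeff f beta v g i).
  move=> t; apply: C1_continuous.
  exact: (C1_omit_coeff fsm sth cth vth subb v (sPhi (basis D)) (fcube (basis D)) i t).
(* The integral over the parallelepiped is the mean over s in [0, 1] of the slice integrals, all of
   which equal the integral over the subtorus. *)
have cubeO i : cube_integral (omit_coeff f beta v g i) =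
    int_cube (torus_cube (Phi D) (row' i (basis D))) eta.
  rewrite (cube_omit_coeff fsm sth cth vth subb v (sPhi (basis D)) (fcube (basis D))).
  under eq_Rintegral do rewrite int_cube_slice.
  by rewrite Rintegral_cst//= lebesgue_measure_itv/= lte01 oppr0 adde0 mulr1.
have -> : h D gamma v = - cube_integral (fun t => \sum_(i < n.+1)
    ((-1) ^+ i * - pairing (row i (basis D)) gamma) * omit_coeff f beta v g i t).
  congr (- cube_integral _); apply/funext => t.
  rewrite -[LHS]/(wedge (contract f gamma (omega X)) eta (g t)
    (fun i => tangent_euclid g t (delta_mx 0 i))).
  rewrite wedge_one//; apply: eq_bigr => i _.
  by rewrite omegaE mulrA.
rewrite (cube_integral_sum _ _ cO) -sumrN; apply: eq_bigr => i _.
by rewrite cubeO mulrN mulNr opprK.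
Qed.

(** This makes the period real, so that normalising Omega merely rescales Im Omega. *)
Lemma im_fibre_integral : fibre_integral D beta = 0.
Proof.
rewrite -[RHS](@cube_integral_cst R n.+1 0); congr cube_integral; apply/funext => t.
apply: vth => [|i]; first by apply: subb; exact: fcube.
exact: (tangent_fibre_vertical fsm _ _ (sPhi (basis D)) (fcube (basis D))).
Qed.

Lemma int_chain_Omega_n (c : chain X n) : chain_in (f @^-1` [set b]) c ->
  int_chain c (contract f v (im_form (Omega_n D))) =
  (complex.Re (fibre_period D))^-1 * int_chain c eta.
Proof.
move=> cA; rewrite /int_chain mulr_sumr.
elim: c cA => [|p c IH]; first by rewrite !big_nil.
rewrite /chain_in /= => /andP[/asboolP[sp fp] cA]; rewrite !big_cons IH//; congr (_ + _).
rewrite mulrCA; congr (_ * _).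
have cp := continuous_contract fsm sth cth vth subb (v := v) sp fp.
rewrite /int_cube -(cube_integralZ _ cp).
congr cube_integral; apply/funext => t.
(* The lift chosen by [contract] depends on the point and on v but not on the form, so it is the
   same on both sides. *)
rewrite /pullback /contract {1}/im_form /Omega_n /fibre_period -/beta im_fibre_integral.
by rewrite Im_divr mulrC.
Qed.

Lemma int_chain_represents (c : chain X n) gamma : represents D c gamma ->
  int_chain c eta = h D gamma v.
Proof.
move=> [cA [a [aE hom]]].
rewrite (int_chain_homologous fsm sth cth vth subb v cA _ hom); last first.
  rewrite /chain_in; elim: (enum _) => //= i r ->; rewrite andbT; apply/asboolP; split.
    exact: sPhi.
  by move=> t; exact: fcube.
rewrite h_period /int_chain big_map enumT; apply: eq_bigr => i _ /=.
by rewrite rmorphM/= rmorphXn/= rmorphN1 aE.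
Qed.

End Fibre.

Lemma period_form_h_n (R : realType) (n : nat) (X : calabi_yau R n.+1)
    (B : manifold R n.+1) (f : X -> B) (b : B) (D : marking f b) (gamma : 'rV[R]_n.+1)
    (c : chain X n) : slag_fibration f -> B0 f b -> represents D c gamma ->
  period_form D c = (fun v => - h_n D gamma v).
Proof.
move=> hf bB0 rc; apply/funext => v; rewrite /period_form /h_n.
rewrite (int_chain_Omega_n hf bB0); last by case: rc.
by rewrite (int_chain_represents hf bB0 v rc) mulrC.
Qed.

Theorem proposition4p7 (R : realType) (n : nat) (X : calabi_yau R n.+1)
    (B : manifold R n.+1) (f : X -> B) (hf : slag_fibration f) :
  (forall (b : B), B0 f b ->
   forall (D : marking f b) (gamma : 'rV[R]_n.+1), dual_lattice f b gamma ->
   forall (c : chain X n), represents D c gamma ->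
     period_form D c = (fun v => - h_n D gamma v)) /\
  (exists eps : R, (eps = 1 \/ eps = -1) /\
   forall (U : set B), open U -> U `<=` B0 f ->
   forall (s : B -> 'rV[R]_n.+1), R1_section f U s ->
   forall (b : B), U b ->
   forall (D : marking f b) (c : chain X n), represents D c (s b) ->
     period_form D c = (fun v => eps * h_n D (s b) v)).
Proof.
split=> [b bB0 D gamma _ c rc|]; first exact: period_form_h_n.
(* One sign serves all sections, base points and markings, since the pointwise identity always
   carries the same minus. *)
exists (-1); split; first by right.
move=> U _ UB0 s _ b Ub D c rc; rewrite (period_form_h_n hf (UB0 b Ub) rc).
by apply/funext => v; rewrite mulN1r.
Qed.
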